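(* A permutation $w \in \mathfrak{S}_n$ is a prism if and only if there exists an integer $i$ such that $w$ contains at least one of the following eight calibrated mesh patterns. Let $R = \{(a,2) : 0 \le a \le 4\} \cup \{(2,b) : 0 \le b \le 4\}$, $U = \{(a,b) : a \in \{0,1,2\},\ b \in \{3,4\}\}$, $D = \{(a,b) : a \in \{3,4\},\ b \in \{0,1,2\}\}$. (1) $(21, \{(0,1),(1,1),(2,1),(2,0)\})$ with $x_2 = i+1$, $y_2 = i+1$; (2) $(21, \{(1,0),(1,1),(1,2),(0,2)\})$ with $x_2 = i+1$, $y_2 = i+1$; (3) $(21, \{(0,1),(1,1),(2,1),(0,2)\})$ with $x_1 = i$, $y_1 = i$; (4) $(21, \{(1,0),(1,1),(1,2),(2,0)\})$ with $x_1 = i$, $y_1 = i$; (5) $(4123, R \cup D)$ with $x_2 = i$, $y_2 = i$; (6) $(2341, R \cup U)$ with $x_2 = i$, $y_2 = i$; (7) $(3142, R \cup U \cup D)$ with $x_2 = i$, $y_2 = i$; (8) $(2413, R \cup U \cup D)$ with $x_2 = i$, $y_2 = i$.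
   Context: Bruhat order: $\sigma_i$ swaps $i,i+1$; a reduced word of $w$ is a minimal-length word $i_1\cdots i_\ell$ with $w=\sigma_{i_1}\cdots\sigma_{i_\ell}$; $u\preceq w$ iff a reduced word of $u$ is a subword of one of $w$; $B(w)=\{u:u\preceq w\}$. A permutation $w$ is a prism if $B(w)\cong\mathbf{2}\times X$ as posets for some poset $X$, where $\mathbf{2}$ is the two-element chain. Calibrated mesh patterns: let $p \in \mathfrak{S}_k$ (written in one-line notation) and $M \subseteq \{0,\dots,k\}^2$ (cell $(a,b)$ is the unit square with lower-left corner $(a,b)$ in the grid $[0,k+1]^2$ containing the graph $\{(j,p(j))\}$ of $p$). An occurrence of $p$ in $w \in \mathfrak{S}_n$ is a choice of positions $x_1<\cdots<x_k$ such that $w(x_1)\cdots w(x_k)$ is in the same relative order as $p(1)\cdots p(k)$; let $y_1<\cdots<y_k$ be the values $\{w(x_1),\dots,w(x_k)\}$ in increasing order, and set $x_0=y_0=0$, $x_{k+1}=y_{k+1}=n+1$. Such an occurrence is an occurrence of the mesh pattern $(p,M)$ if for every $(a,b)\in M$ there is no $x$ with $x_a < x < x_{a+1}$ and $y_b < w(x) < y_{b+1}$. A calibrated mesh pattern additionally prescribes values for some of the $x_a$ (positions) and $y_b$ (values); $w$ contains it if $w$ has an occurrence of $(p,M)$ meeting those prescriptions. *)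

(* Defs.v *)
From mathcomp Require Import all_boot all_order all_fingroup all_algebra.
Set Implicit Arguments. Unset Strict Implicit. Unset Printing Implicit Defensive.

(* sigma_i (1 <= i < n) swaps the values/positions i and i+1 (1-indexed),
   i.e. the 0-indexed points i-1 and i of 'I_n. *)
Definition sigma (n : nat) (i : nat) : 'S_n :=
  match (insub i.-1 : option 'I_n), (insub i : option 'I_n) with
  | Some a, Some b => tperm a b
  | _, _ => 1%g
  end.

Definition valid_word (n : nat) (s : seq nat) : bool :=
  all (fun i => (0 < i) && (i < n)) s.

Definition word_prod (n : nat) (s : seq nat) : 'S_n :=
  foldr (fun i acc => (sigma n i * acc)%g) 1%g s.

Definition reduced_word (n : nat) (w : 'S_n) (s : seq nat) : Prop :=
  [/\ valid_word n s, word_prod n s = w &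
      forall s', valid_word n s' -> word_prod n s' = w -> size s <= size s'].

Definition bruhat_le (n : nat) (u w : 'S_n) : Prop :=
  exists su sw, [/\ reduced_word u su, reduced_word w sw & subseq su sw].

Definition Bint (n : nat) (w : 'S_n) : Type := {u : 'S_n | bruhat_le u w}.

Definition prod2_le (T : Type) (leT : T -> T -> Prop) (p q : bool * T) : Prop :=
  (p.1 ==> q.1) /\ leT p.2 q.2.

Definition is_poset (T : Type) (leT : T -> T -> Prop) : Prop :=
  [/\ forall x, leT x x,
      forall x y, leT x y -> leT y x -> x = y &
      forall x y z, leT x y -> leT y z -> leT x z].

Definition prism (n : nat) (w : 'S_n) : Prop :=
  exists (T : Type) (leT : T -> T -> Prop), is_poset leT /\
    exists (f : Bint w -> bool * T) (g : bool * T -> Bint w),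
      [/\ cancel f g, cancel g f &
          forall u v : Bint w, bruhat_le (sval u) (sval v) <-> prod2_le leT (f u) (f v)].

(* w as a function on positions 1..n with values 1..n (0 outside) *)
Definition wf (n : nat) (w : 'S_n) (x : nat) : nat :=
  if x is x'.+1 then
    (if (insub x' : option 'I_n) is Some j then (val (w j)).+1 else 0)
  else 0.

Definition Xc (n k : nat) (xs : seq nat) (a : nat) : nat :=
  if a == 0 then 0 else if a == k.+1 then n.+1 else nth 0 xs a.-1.

Definition Yc (n k : nat) (w : 'S_n) (xs : seq nat) (b : nat) : nat :=
  Xc n k (sort leq (map (wf w) xs)) b.

Definition mesh_occ (n : nat) (w : 'S_n) (p : seq nat) (M : seq (nat * nat))
    (xs : seq nat) : Prop :=
  let k := size p in
  [/\ size xs = k, sorted ltn xs, all (fun x => (0 < x) && (x <= n)) xs,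
      forall j l, j < k -> l < k ->
        (wf w (nth 0 xs j) < wf w (nth 0 xs l)) = (nth 0 p j < nth 0 p l) &
      forall a b, (a, b) \in M -> forall x,
        Xc n k xs a < x < Xc n k xs a.+1 ->
        ~~ ((Yc k w xs b < wf w x) && (wf w x < Yc k w xs b.+1))].

Definition contains_cmp (n : nat) (w : 'S_n) (p : seq nat) (M : seq (nat * nat))
    (cx cy : seq (nat * int)) : Prop :=
  exists xs, [/\ mesh_occ w p M xs,
    all (fun c => Posz (Xc n (size p) xs c.1) == c.2) cx &
    all (fun c => Posz (Yc (size p) w xs c.1) == c.2) cy].

Definition meshR : seq (nat * nat) :=
  [seq (a, 2) | a <- iota 0 5] ++ [seq (2, b) | b <- iota 0 5].
Definition meshU : seq (nat * nat) :=
  [seq (a, b) | a <- iota 0 3, b <- [:: 3; 4]].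
Definition meshD : seq (nat * nat) :=
  [seq (a, b) | a <- [:: 3; 4], b <- iota 0 3].

(* Main.v *)
Require Import Defs.
From mathcomp Require Import all_boot all_order all_fingroup all_algebra.
From mathcomp Require Import zify.
From Stdlib Require Import ProofIrrelevance.
Set Implicit Arguments. Unset Strict Implicit. Unset Printing Implicit Defensive.

(* If B(w) = 2 x X, the least element with first coordinate 1 is an atom s_i, and
   s_i has at most one common upper cover with any other atom s_j; so for j = i +- 1
   the products s_i s_j and s_j s_i are not both below w.  In a reduced word of w
   the letter i then occurs exactly once (two consecutive occurrences would enclose
   a letter i +- 1), and each of i - 1, i + 1 occurs on one side of it only.  On the
   level of permutations: exactly one p <= i has w(p) > i, exactly one q > i has
   w(q) <= i, and [p = i or w(q) = i] and [q = i+1 or w(p) = i+1].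

   Conversely such a w is v_A s_i v_B, where v = v_A v_B preserves {1..i} and each of
   v_A, v_B is v restricted to a union of the blocks {1..i}, {i+1..n}; inserting s_i
   into words shows that u |-> u, u |-> u_A s_i u_B is an isomorphism from 2 x B(v)
   to B(w).  The eight patterns list the ways in which the two disjunctions hold. *)

(** * Bruhat order and inversions *)

Section Bruhat.
Variable n : nat.
Local Open Scope group_scope.
Implicit Types (u v w : 'S_n) (s t : seq nat).

Lemma sigmaE i : 0 < i < n ->
  exists a b : 'I_n, [/\ a = i.-1 :> nat, b = i :> nat & sigma n i = tperm a b].
Proof.
case/andP=> i0 lin.
have li1n : i.-1 < n by lia.
exists (Ordinal li1n), (Ordinal lin); split=> //.
by rewrite /sigma !insubT.
Qed.

(** For [i = 0] the truncated predecessor makes the two points coincide; for [i >= n] the default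
    branch applies. *)
Lemma sigmaVE i : sigma n i = 1 \/ 0 < i < n.
Proof.
case: (boolP (0 < i < n)); first by right.
rewrite /sigma; case: (ltnP i n) => [lin|nin]; last first.
  by left; rewrite [insub i]insubN -?leqNgt //; case: insub.
rewrite andbT -eqn0Ngt => /eqP i0; left; subst i.
by rewrite insubT tperm1.
Qed.

(** An adjacent transposition reverses no pair but its own. *)
Lemma sigma_ltn i (a b : 'I_n) : a < b ->
  sigma n i a < sigma n i b \/ sigma n i = tperm a b.
Proof.
move=> lab; case: (sigmaVE i) => [->|/sigmaE [c [d [Ec Ed ->]]]].
  by left; rewrite !perm1.
have val_neq (x y : 'I_n) : x <> y -> x <> y :> nat by move=> H /val_inj.
case: tpermP => [Ea|Ea|/val_neq ac /val_neq ad];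
  case: tpermP => [Eb|Eb|/val_neq bc /val_neq bd]; subst; try lia; try (by right);
  left; lia.
Qed.

Lemma word_prod_cat s t : word_prod n (s ++ t) = word_prod n s * word_prod n t.
Proof. by elim: s => [|i s IH] /=; rewrite ?mul1g // IH mulgA. Qed.

Lemma subseq_valid s t : subseq s t -> valid_word n t -> valid_word n s.
Proof. by move=> st /allP vt; apply/allP => i /(mem_subseq st) /vt. Qed.

Lemma valid_word_cat s t :
  valid_word n (s ++ t) = valid_word n s && valid_word n t.
Proof. exact: all_cat. Qed.

(* Strong exchange: conjugating past a letter other than [tperm a b] itself keeps
   the inverted pair in increasing order. *)
Lemma strong_exchange s (a b : 'I_n) :
    a < b -> word_prod n s b < word_prod n s a ->
  exists s', [/\ subseq s' s, size s = (size s').+1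
                & word_prod n s' = tperm a b * word_prod n s].
Proof.
elim: s a b => [|i s IH] a b lab /=; first by rewrite !perm1 => h; lia.
case: (sigma_ltn i lab) => [lt_ab|->] inv.
  rewrite !permM in inv; have [s' [ss' Es Ps]] := IH _ _ lt_ab inv.
  exists (i :: s'); split; rewrite /= ?eqxx ?Es // Ps.
  by rewrite -tpermJ conjgE !mulgA mulgV mul1g.
exists s; split=> //; last by rewrite mulgA tperm2 mul1g.
exact: subseq_cons.
Qed.

(* [(tperm a b * w) x = w (tperm a b x)]: left multiplication acts on positions. *)
Definition invstep w u :=
  [exists a : 'I_n, exists b : 'I_n,
    [&& a < b, w b < w a & u == tperm a b * w]].

Lemma invstepP w u :
  reflect (exists a b : 'I_n, [/\ a < b, w b < w a & u = tperm a b * w])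
          (invstep w u).
Proof.
apply: (iffP existsP) => [[a /existsP [b /and3P [h1 h2 /eqP h3]]]|[a [b [h1 h2 ->]]]].
  by exists a, b.
by exists a; apply/existsP; exists b; rewrite h1 h2 eqxx.
Qed.

(** The Bruhat order described by reflections. The larger element comes first: a path starts there
    and undoes one inversion per step. *)
Definition below w u := connect invstep w u.

Lemma below_ind (P : 'S_n -> Prop) w u :
  P w -> (forall x y, below w x -> P x -> invstep x y -> P y) -> below w u -> P u.
Proof.
move=> Pw Pstep /connectP [p]; elim/last_ind: p u => [|p x IH] u /=.
  by move=> _ ->.
rewrite rcons_path last_rcons => /andP [wp st] ->.
by apply: (Pstep _ _ _ (IH _ wp erefl) st); apply/connectP; exists p.
Qed.

(** By strong exchange, undoing an inversion amounts to deleting a letter. *)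
Lemma below_subword s u : below (word_prod n s) u ->
  exists2 s', subseq s' s & word_prod n s' = u.
Proof.
apply: (below_ind (P := fun u => exists2 s', subseq s' s & word_prod n s' = u)).
  by exists s.
move=> x y _ [s' ss' <-] /invstepP [a [b [lab inv ->]]].
have [t [tt' _ Pt]] := strong_exchange lab inv.
by exists t; first exact: subseq_trans ss'.
Qed.

Lemma sigma2 i : sigma n i * sigma n i = 1.
Proof.
by case: (sigmaVE i) => [->|/sigmaE [a [b [_ _ ->]]]]; rewrite ?mulg1 ?tperm2.
Qed.

Lemma sigmaK i : involutive (sigma n i).
Proof. by move=> x; rewrite -permM sigma2 perm1. Qed.

(** Induction on the word. If the new letter undoes an inversion of the tail, exchange deletes a
    letter from the reduced word of the tail. Otherwise the length grows: exchange turns any word of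
    the product into a word of the tail with one letter less. *)
Lemma reduced_subword s : valid_word n s ->
  exists2 t, subseq t s & reduced_word (word_prod n s) t.
Proof.
elim: s => [|i s IH] /=; first by exists [::].
move=> /andP [vi vs]; have [t ts [vt Pt mint]] := IH vs.
have [a [b [Ea Eb Es]]] := sigmaE vi.
have lab : a < b by lia.
have [inv|asc] := ltnP (word_prod n s b) (word_prod n s a).
  rewrite -Pt in inv; have [t' [tt' St Pt']] := strong_exchange lab inv.
  exists t'; first exact: subseq_trans tt' (subseq_trans ts (subseq_cons _ _)).
  split; [exact: subseq_valid vt| by rewrite Pt' Pt Es|].
  move=> s' vs' Ps'; rewrite -ltnS -St; apply: (mint (i :: s')) => /=.
    by rewrite vi.
  by rewrite Ps' mulgA sigma2 mul1g.
exists (i :: t); first by rewrite /= eqxx.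
split=> /=; [by rewrite vi | by rewrite Pt|].
move=> s' vs' Ps'.
have inv : word_prod n s' b < word_prod n s' a.
  rewrite Ps' Es !permM tpermL tpermR ltn_neqAle asc andbT.
  by rewrite (inj_eq val_inj) (inj_eq perm_inj); apply/eqP => E; rewrite E ltnn in lab.
have [t' [tt' -> Pt']] := strong_exchange lab inv.
rewrite ltnS; apply: mint; first exact: subseq_valid vs'.
by rewrite Pt' -Es Ps' mulgA sigma2 mul1g.
Qed.

(** Induction on [b - a]: conjugating [tperm a b.-1] by the letter [b], which swaps the points
    [b.-1] and [b], gives [tperm a b]. *)
Lemma tperm_word (a b : 'I_n) :
  exists2 s, valid_word n s & word_prod n s = tperm a b.
Proof.
wlog lab : a b / a <= b.
  by move=> H; case: (leqP a b) => [/H //|/ltnW /H]; rewrite tpermC.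
have [k Ek] : exists k, b = a + k :> nat by exists (b - a); lia.
elim: k a b lab Ek => [|k IH] a b lab Ek.
  exists [::] => //=; have -> : a = b by apply: val_inj; rewrite /= Ek addn0.
  by rewrite tperm1.
have lcn : b.-1 < n by have := ltn_ord b; lia.
pose c := Ordinal lcn.
have vb : 0 < b < n by have := ltn_ord b; lia.
have [c' [b' [Ec Eb Es]]] := sigmaE vb.
have {}Ec : c' = c by apply: val_inj.
have {}Eb : b' = b by apply: val_inj.
rewrite {c'}Ec {b'}Eb in Es.
have lac : a <= c by rewrite /=; lia.
have Ekc : c = a + k :> nat by rewrite /=; lia.
have [s vs Ps] := IH a c lac Ekc.
have [Ea|nac] := eqVneq a c.
  by exists [:: b : nat]; rewrite /= ?vb // mulg1 Es Ea.
exists ((b : nat) :: s ++ [:: b : nat]).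
  by rewrite /= vb; have := valid_word_cat s [:: b : nat] => ->; rewrite vs /= vb.
rewrite /= word_prod_cat Ps /= mulg1 Es.
have -> : tperm c b * (tperm a c * tperm c b) = tperm a c ^ tperm c b.
  by rewrite conjgE tpermV mulgA.
rewrite tpermJ tpermL tpermD // 1?eq_sym //.
by apply/eqP => E; move: lac Ekc Ek; rewrite /= -E; lia.
Qed.

Lemma reduced_word_exists w : exists s, reduced_word w s.
Proof.
suff [s vs <-] : exists2 s, valid_word n s & word_prod n s = w.
  by have [t _ ?] := reduced_subword vs; exists t.
have [ts -> _] := prod_tpermP w.
elim: ts => [|x ts [s vs Ps]]; first by exists [::]; rewrite ?big_nil.
have [t vt Pt] := tperm_word x.1 x.2.
exists (t ++ s); first by rewrite valid_word_cat vt.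
by rewrite word_prod_cat Pt Ps big_cons.
Qed.

(** If the pair of the first letter were not inverted in [w], it would be inverted in the tail, and
    exchange there would give a word of [w] two letters shorter. *)
Lemma reduced_tail i s w : reduced_word w (i :: s) ->
  reduced_word (word_prod n s) s /\ invstep w (word_prod n s).
Proof.
case=> /= /andP [vi vs] Pw minw; split.
  split=> // s' vs' Ps'.
  have := minw (i :: s'); rewrite /= vi Ps' Pw ltnS; exact.
have [a [b [Ea Eb Es]]] := sigmaE vi; have lab : a < b by lia.
apply/invstepP; exists a, b; split=> //; last first.
  by rewrite -Pw -Es mulgA sigma2 mul1g.
rewrite -Pw Es !permM tpermL tpermR.
case: (ltnP (word_prod n s a) (word_prod n s b)) => //; rewrite leq_eqVlt.
case/orP=> [|inv].
  by rewrite (inj_eq val_inj) (inj_eq perm_inj) => /eqP E; rewrite E ltnn in lab.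
have [t [tt' St Pt]] := strong_exchange lab inv.
have := minw t (subseq_valid tt' vs); rewrite Pt -Es => /(_ Pw); lia.
Qed.

(* A step by [sigma n i] itself becomes trivial after lifting; every other step
   is conjugated to a step. *)
Lemma below_lift i x y w :
  below w x -> below w (sigma n i * x) -> below x y -> below w (sigma n i * y).
Proof.
move=> wx wsx; apply: (below_ind (P := fun y => below w (sigma n i * y))) => //.
move=> {}y z xy IH /invstepP [a [b [lab inv ->]]].
have wy : below w y := connect_trans wx xy.
case: (sigma_ltn i lab) => [lt_ab|->]; last by rewrite mulgA tperm2 mul1g.
apply: connect_trans IH _; apply: connect1; apply/invstepP.
exists (sigma n i a), (sigma n i b); split=> //.
  by rewrite !permM !sigmaK.
have sV : (sigma n i)^-1 = sigma n i.
  by apply/eqP; rewrite eq_invg_mul sigma2.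
by rewrite -tpermJ conjgE sV !mulgA -(mulgA _ (sigma n i) (sigma n i)) sigma2 mulg1.
Qed.

(** A subword that skips the first letter lies below the tail, one step down from [w]. One that
    keeps it is reached by lifting a path that starts at the tail. *)
Lemma subword_below s t w :
  reduced_word w s -> subseq t s -> below w (word_prod n t).
Proof.
elim: s t w => [|i s IH] t w red.
  by case: red => _ /= <- _; case: t => // _; apply: connect0.
have [redt /connect1 st] := reduced_tail red.
case: t => [|j t]; first by move=> _; apply: connect_trans st (IH [::] _ redt (sub0seq _)).
rewrite /=; case: eqP => [-> ts|_ ts]; last exact: connect_trans st (IH _ _ redt ts).
apply: below_lift st _ (IH _ _ redt ts).
by case: red => _ <- _; apply: connect0.
Qed.

(** Replaces the order by a reachability relation, which is transitive by construction. The subword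
    found along a path may fail to be reduced and is thinned once more. *)
Lemma bruhat_leP u w : bruhat_le u w <-> below w u.
Proof.
split=> [[su [sw [[_ <- _] redw sub]]]|wu]; first exact: subword_below redw sub.
have [s red] := reduced_word_exists w; have [vs Pw _] := red.
rewrite -Pw in wu; have [s' ss' Ps'] := below_subword wu.
have [t ts redt] := reduced_subword (subseq_valid ss' vs).
by exists t, s; split=> //; [rewrite -Ps'|apply: subseq_trans ss'].
Qed.

(** All reduced words of one permutation have the same length, so a reduced word that is a subword
    in both directions is the whole word. *)
Lemma below_anti u w : below w u -> below u w -> u = w.
Proof.
move=> /bruhat_leP [su [sw [ru rw sub]]] /bruhat_leP [sw' [su' [rw' ru' sub']]].
have [[vu Pu mu] [vw Pw mw]] := (ru, rw).
have [[vu' Pu' mu'] [vw' Pw' mw']] := (ru', rw').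
have le1 := size_subseq sub'; have le2 := mu' _ vu Pu; have le3 := mw _ vw' Pw'.
suff E : su = sw by rewrite -Pu -Pw E.
apply/eqP; rewrite -(size_subseq_leqif sub) eqn_leq size_subseq //=.
exact: leq_trans le3 (leq_trans le1 le2).
Qed.

End Bruhat.

(** * Prisms and the letter i *)

Section Forward.
Variable n : nat.
Local Open Scope group_scope.
Implicit Types (u v w : 'S_n) (s t : seq nat).

Definition no_double_join w i := forall j,
  0 < j < n -> j = i.+1 \/ i = j.+1 ->
  ~ (below w (sigma n i * sigma n j) /\ below w (sigma n j * sigma n i)).

Lemma below1 w : below w 1.
Proof.
have [s red] := reduced_word_exists w.
exact: (subword_below red (sub0seq s)).
Qed.

Lemma below_letter w u : below w u -> u != 1 ->
  exists2 i, 0 < i < n & below u (sigma n i).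
Proof.
have [s red] := reduced_word_exists u => _; case: (red) => vs <- _.
case: s vs red => [|i s] /=; first by rewrite eqxx.
case/andP=> vi _ red _; exists i => //.
have sub : subseq [:: i] (i :: s) by rewrite /= eqxx sub0seq.
by have := subword_below red sub; rewrite /= mulg1; case: red => _ <- _.
Qed.

Lemma below_sigma i u : below (sigma n i) u -> u = 1 \/ u = sigma n i.
Proof.
have {1}-> : sigma n i = word_prod n [:: i] by rewrite /= mulg1.
case/below_subword => s sub <-.
case: s sub => [|k [|l s]] /=; first by left.
  by case: (k =P i) => [->|_] // _; right; rewrite mulg1.
by case: (k =P i).
Qed.

Lemma below_sigma2 i j u : below (sigma n i * sigma n j) u ->
  [\/ u = 1, u = sigma n i, u = sigma n j | u = sigma n i * sigma n j].
Proof.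
have {1}-> : sigma n i * sigma n j = word_prod n [:: i; j] by rewrite /= mulg1.
case/below_subword => s sub <-.
case: s sub => [|k s] /=; first by constructor 1.
case: (k =P i) => [->|_].
  case: s => [|l s] /=; first by rewrite mulg1; constructor 2.
  by case: (l =P j) => [->|_] //; case: s => // _; rewrite mulg1; constructor 4.
by case: (k =P j) => [->|_] //; case: s => // _; rewrite mulg1; constructor 3.
Qed.

Lemma sigma_neq1 i : 0 < i < n -> sigma n i != 1.
Proof.
move=> vi; have [a [b [Ea Eb ->]]] := sigmaE vi.
apply/eqP => /permP /(_ a); rewrite tpermL perm1 => E.
by have := congr1 val E; rewrite /= Eb Ea; lia.
Qed.

Lemma sigma_noncomm i j : 0 < i < n -> 0 < j < n -> j = i.+1 \/ i = j.+1 ->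
  sigma n i * sigma n j <> sigma n j * sigma n i.
Proof.
wlog : i j / j = i.+1.
  move=> H vi vj [E|E] C; first exact: (H i j E vi vj (or_introl E)).
  exact: (H j i E vj vi (or_introl E)).
move=> -> vi vj _.
have [a [b [Ea Eb ->]]] := sigmaE vi; have [b' [c [Eb' Ec ->]]] := sigmaE vj.
have {Eb'} -> : b' = b by apply: val_inj; rewrite /= Eb' Eb.
move=> /permP /(_ a); rewrite !permM tpermL [tperm b c b]tpermL.
have -> : tperm b c a = a by rewrite tpermD // -val_eqE /= ?Ea ?Eb ?Ec; lia.
by rewrite !tpermL => E; have := congr1 val E; rewrite /= ?Eb ?Ec; lia.
Qed.

(** The word [[:: i; j]] is reduced: a proper subword with the same product would force the two
    letters to be equal or one of them to be trivial. *)
Lemma below_sigma_pair i j : 0 < i < n -> 0 < j < n -> j = i.+1 \/ i = j.+1 ->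
  below (sigma n i * sigma n j) (sigma n i) /\
  below (sigma n i * sigma n j) (sigma n j).
Proof.
move=> vi vj adj; have vij : valid_word n [:: i; j] by rewrite /= vi vj.
have nc := sigma_noncomm vi vj adj.
have [t sub red] := reduced_subword vij.
suff Et : t = [:: i; j].
  rewrite Et /= mulg1 in red; split.
    rewrite -[X in below _ X]mulg1; apply: (@subword_below n _ [:: i] _ red).
    exact: (prefix_subseq [:: i] [:: j]).
  rewrite -[X in below _ X]mulg1; apply: (@subword_below n _ [:: j] _ red).
  exact: (suffix_subseq [:: i] [:: j]).
have [_ Pt _] := red; move: Pt {red}; rewrite /= mulg1.
case: t sub => [|k t] /=.
  move=> _ E; case: nc.
  have -> // : sigma n j = sigma n i.
  by rewrite -[LHS]mul1g -(sigma2 n i) -mulgA -E mulg1.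
have s1 m : 0 < m < n -> sigma n m <> 1 by move=> vm; apply/eqP/sigma_neq1.
case: (k =P i) => [->|_].
  case: t => [|l t] /=.
    rewrite mulg1 => _ /esym/eqP.
    by rewrite -{2}[sigma n i]mulg1 (inj_eq (mulgI _)) => /eqP/s1.
  by case: (l =P j) => [->|_] //; case: t.
case: (k =P j) => [->|_] //; case: t => // _.
rewrite mulg1 => /esym/eqP.
by rewrite -{2}[sigma n j]mul1g (inj_eq (mulIg _)) => /eqP/s1.
Qed.

(* In [2 x X] the least element with first coordinate [true] is an atom
   [sigma_i], and two atoms [(true,0)], [(false,y)] have the unique upper cover
   [(true,y)] in common. *)
Lemma prism_no_double_join w : prism w ->
  exists i, [/\ 0 < i < n, below w (sigma n i) & no_double_join w i].
Proof.
case=> T [leT [[rT aT tT] [f [g [fK gK ford]]]]].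
have gord p q : below (sval (g q)) (sval (g p)) <-> prod2_le leT p q.
  by rewrite -bruhat_leP ford !gK.
have mk u : below w u -> exists p, sval (g p) = u.
  move=> /bruhat_leP le_uw; exists (f (exist _ u le_uw)); by rewrite fK.
have gw p : below w (sval (g p)) by apply/bruhat_leP; case: (g p).
(* Elements of [Bint w] carry proofs, so equality of the permutations is turned into equality of the
   coordinates by antisymmetry. *)
have ginj p q : sval (g p) = sval (g q) -> p = q.
  move=> E; have [h1 h2] : prod2_le leT p q /\ prod2_le leT q p.
    by split; apply/gord; rewrite E; apply: connect0.
  case: p q {E} h1 h2 => [p1 p2] [q1 q2] [/= i1 l1] [/= i2 l2].
  by rewrite (aT _ _ l1 l2); congr pair; case: p1 q1 i1 i2 => [] [].
(* The identity is least, hence has coordinates [false] and the least element [x0] of [T]. *)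
have [[e x0] Ee] := mk 1 (below1 w).
have min_e p : prod2_le leT (e, x0) p by apply/gord; rewrite Ee; apply: below1.
have e0 : e = false by have [] := min_e (false, x0); case: (e).
subst e.
have minx x : leT x0 x by have [] := min_e (true, x).
have tneq : sval (g (true, x0)) != 1.
  by apply/eqP => E; have := ginj (true, x0) (false, x0); rewrite E Ee => /(_ erefl).
(* Only [(false, x0)], which is the identity, and [(true, x0)] itself lie below [(true, x0)]; so a
   letter below it is equal to it. *)
have [i vi ti] := below_letter (gw (true, x0)) tneq.
have [[d x] Ex] := mk _ (connect_trans (gw (true, x0)) ti).
rewrite -Ex in ti; have [_ /= lx] := (gord _ _).1 ti.
have Ex0 : x = x0 by apply: aT.
subst x; case: d Ex ti => [Et|E1]; last first.
  by have := sigma_neq1 vi; rewrite -E1 Ee eqxx.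
move=> _; exists i; split=> //; first by rewrite -Et.
move=> j vj adj [wij wji]; apply: (sigma_noncomm vi vj adj).
have [[d y] Ey] := mk _ (connect_trans wij (below_sigma_pair vi vj adj).2).
(* With first coordinate [true], [sigma n j] would lie above [(true, x0)], which is [sigma n i]. *)
have y0 : d = false.
  case: d Ey => // Ey; have : below (sigma n j) (sigma n i).
    by rewrite -Et -Ey; apply/gord; split => //=; apply: minx.
  case/below_sigma => E; first by have := sigma_neq1 vi; rewrite E eqxx.
  by case: (sigma_noncomm vi vj adj); rewrite E.
subst d.
(* A common upper bound [u] of both atoms lies above [(true, y)]. If nothing but the identity, the
   two atoms and [u] is below [u], then [u] is [(true, y)]. Both products are such bounds, so they
   would coincide. *)
suff joinE u : below w u -> below u (sigma n i) -> below u (sigma n j) ->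
    (forall x, below u x -> [\/ x = 1, x = sigma n i, x = sigma n j | x = u]) ->
    u = sval (g (true, y)).
  have adj' : i = j.+1 \/ j = i.+1 by case: adj; [right|left].
  have [iji ijj] := below_sigma_pair vi vj adj.
  have [jij jii] := below_sigma_pair vj vi adj'.
  rewrite (joinE _ wij iji ijj); last exact: below_sigma2.
  rewrite (joinE _ wji jii jij) // => x /below_sigma2.
  by case=> ->; [constructor 1|constructor 3|constructor 2|constructor 4].
move=> wu ui uj uE; have [[d z] Ez] := mk _ wu.
rewrite -Ez -Et in ui; rewrite -Ez -Ey in uj.
have {ui} /= [dT _] := (gord _ _).1 ui; have {uj} /= [_ yz] := (gord _ _).1 uj.
have {}dT : d = true by case: (d) dT.
subst d; have : below u (sval (g (true, y))) by rewrite -Ez; apply/gord.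
case/uE => // E.
- by have := ginj (true, y) (false, x0); rewrite E Ee => /(_ erefl).
- have := ginj (true, y) (true, x0); rewrite E Et => /(_ erefl) [Ex].
  by have := sigma_neq1 vj; rewrite -Ey Ex Ee eqxx.
- by have := ginj (true, y) (false, y); rewrite E Ey => /(_ erefl).
Qed.

End Forward.

(** * From reduced words to a single crossing of the boundary *)

Section Cross.
Variable n : nat.
Local Open Scope group_scope.
Implicit Types (u v w : 'S_n) (s t : seq nat) (p q x : 'I_n).

(** The Young subgroup of type [(i, n - i)], generated by the letters other than [i]. *)
Definition young i v := forall x, (v x < i) = (x < i).

Lemma young_sigma i j : j != i -> young i (sigma n j).
Proof.
move=> nij x; case: (sigmaVE n j) => [->|/sigmaE [a [b [Ea Eb ->]]]].
  by rewrite perm1.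
by case: tpermP => [->|->|//]; lia.
Qed.

Lemma young_word i s : i \notin s -> young i (word_prod n s).
Proof.
elim: s => [|j s IH] /=; first by move=> _ x; rewrite perm1.
rewrite inE negb_or => /andP [nij /IH yI] x.
by rewrite permM yI young_sigma // eq_sym.
Qed.

(** Letter [j] swaps the points [j.-1] and [j], so only the letters [x] and [x.+1] can move [x]. *)
Lemma word_fix s x : (x : nat) \notin s -> x.+1 \notin s -> word_prod n s x = x.
Proof.
elim: s => [|j s IH] /=; first by rewrite perm1.
rewrite !inE !negb_or => /andP [nxj xs] /andP [nxj' xs'].
rewrite permM; have -> : sigma n j x = x; last exact: IH.
case: (sigmaVE n j) => [->|vj]; first by rewrite perm1.
have [a [b [Ea Eb ->]]] := sigmaE vj.
by rewrite tpermD // -val_eqE /=; apply/eqP; lia.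
Qed.

(* Points of ['I_n] are 0-indexed: the block {1..i} of the paper is [x < i]. *)
Definition crossing w i p q :=
  [/\ p < i, i <= q, i <= w p, w q < i
    & forall x, x != p -> x != q -> (w x < i) = (x < i)].

(** The disjunctions say on which side of the letter [i] a neighbour is absent. Absence of [i.-1]
    before it gives [p = i.-1], after it [w q = i.-1]; likewise [i.+1] gives [q = i] or
    [w p = i]. *)
Definition oneway w i p q :=
  [/\ crossing w i p q, p = i.-1 :> nat \/ w q = i.-1 :> nat
    & q = i :> nat \/ w p = i :> nat].

Lemma word_commute i s : i.-1 \notin s -> i.+1 \notin s -> i \notin s ->
  sigma n i * word_prod n s = word_prod n s * sigma n i.
Proof.
move=> h1 h2 h3; case: (sigmaVE n i) => [->|vi]; first by rewrite mul1g mulg1.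
have [a [b [Ea Eb ->]]] := sigmaE vi.
have Ga : word_prod n s a = a by apply: word_fix; rewrite Ea ?prednK //; lia.
have Gb : word_prod n s b = b by apply: word_fix; rewrite Eb.
have E : tperm a b ^ word_prod n s = tperm a b by rewrite tpermJ Ga Gb.
by rewrite -{2}E conjgE !mulgA mulgV mul1g.
Qed.

Lemma sub2seq_cat (T : eqType) (x y : T) (s1 s2 : seq T) :
  x \in s1 -> y \in s2 -> subseq [:: x; y] (s1 ++ s2).
Proof.
by rewrite -!sub1seq => h1 h2; apply: (cat_subseq (s1 := [:: x]) (s2 := [:: y])).
Qed.

Lemma split_first (T : eqType) (x : T) (s : seq T) : x \in s ->
  exists s1 s2 : seq T, s = s1 ++ x :: s2 /\ x \notin s1.
Proof.
elim: s => [//|y s IH]; have [->|nxy] := eqVneq x y; first by exists [::], s.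
rewrite inE (negPf nxy) => /IH [s1 [s2 [-> nx]]].
by exists (y :: s1), s2; rewrite inE negb_or nxy.
Qed.

Lemma oneway_of_no_double_join w i :
  0 < i < n -> below w (sigma n i) -> no_double_join w i ->
  exists p q, oneway w i p q.
Proof.
move=> vi wi ndj; have [s red] := reduced_word_exists w.
have [vs Pw minw] := red.
(* By the subword property, the two orders of [i] and a neighbour do not both occur in [s]. *)
have ndw j : j = i.+1 \/ i = j.+1 ->
    ~ (subseq [:: i; j] s /\ subseq [:: j; i] s).
  move=> adj [sij sji]; have vj : 0 < j < n.
    by apply: (allP vs); apply: (mem_subseq sij); rewrite !inE eqxx orbT.
  apply: (ndj j vj adj); split.
    by have := subword_below red sij; rewrite /= mulg1.
  by have := subword_below red sji; rewrite /= mulg1.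
(* Otherwise every subword of [s] would preserve the blocks, which [sigma n i] does not. *)
have si : i \in s.
  move: wi; rewrite -Pw => /below_subword [s' ss' Ps'].
  apply/negPn/negP => nis; have nis' : i \notin s'.
    by apply: contraNN nis => /(mem_subseq ss').
  have := young_word nis'; rewrite Ps'.
  have [a [b [Ea Eb ->]]] := sigmaE vi => /(_ a).
  by rewrite tpermL; lia.
have [s1 [s2 [Es nis1]]] := split_first si.
have [a [b [Ea Eb Eab]]] := sigmaE vi.
(* Between two consecutive letters [i] a neighbour would occur both after and before an [i]. Without
   neighbours the first [i] commutes past [c] and cancels the second, against minimality. *)
have nis2 : i \notin s2.
  apply/negP => /split_first [c [d [Ed nic]]].
  have ndc j : j = i.+1 \/ i = j.+1 -> j \notin c.
    move=> adj; apply/negP => jc; apply: (ndw j adj); rewrite Es Ed; split.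
      apply: subseq_trans (suffix_subseq _ _).
      apply: subseq_trans (prefix_subseq (i :: c) (i :: d)).
      by apply: (sub2seq_cat (s1 := [:: i])); rewrite ?inE.
    apply: subseq_trans (suffix_subseq _ _).
    apply: subseq_trans (subseq_cons _ _).
    by apply: sub2seq_cat; rewrite ?inE ?eqxx.
  have vsub : valid_word n (s1 ++ c ++ d).
    move: vs; rewrite Es Ed !valid_word_cat /= !valid_word_cat /=.
    by case/and5P=> -> _ -> _ ->.
  have := minw _ vsub; rewrite -Pw Es Ed !word_prod_cat /= !word_prod_cat /=.
  have -> : word_prod n c * (sigma n i * word_prod n d) =
            sigma n i * word_prod n c * word_prod n d.
    have h1 : i.-1 \notin c by apply: ndc; right; lia.
    have h2 : i.+1 \notin c by apply: ndc; left.
    by rewrite (word_commute h1 h2 nic) mulgA.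
  rewrite !mulgA -[_ * sigma n i * sigma n i]mulgA sigma2 mulg1 => /(_ erefl).
  by rewrite !size_cat /= !size_cat /=; lia.
have once j : j = i.+1 \/ i = j.+1 -> j \notin s1 \/ j \notin s2.
  move=> adj; have [j1|] := boolP (j \in s1); last by left.
  right; apply/negP => j2; apply: (ndw j adj); rewrite Es; split.
    apply: subseq_trans (suffix_subseq _ _).
    by apply: (sub2seq_cat (s1 := [:: i])); rewrite ?inE.
  by apply: sub2seq_cat; rewrite ?inE ?eqxx.
have y1 := young_word nis1; have y2 := young_word nis2.
move: Pw; rewrite Es word_prod_cat /=.
set f := word_prod n s1 in y1 *; set g := word_prod n s2 in y2 *; rewrite Eab => Pw.
(* Since [w] is [f], then the swap of [a] and [b], then [g], with [f] and [g] preserving the blocks,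
   the crossing points are those that [f] sends to [a] and [b]. *)
exists (f^-1 a), (f^-1 b); have wp : w (f^-1 a) = g b by rewrite -Pw !permM permKV tpermL.
have wq : w (f^-1 b) = g a by rewrite -Pw !permM permKV tpermR.
have fixf x : (x : nat) \notin s1 -> x.+1 \notin s1 -> f^-1 x = x.
  by move=> h1 h2; rewrite -[in LHS](word_fix h1 h2) permK.
split.
- have pa x : (f^-1 x < i) = (x < i) by rewrite -[in RHS](permKV f x) y1.
  split; rewrite ?wp ?wq ?pa ?y2; try (by lia).
  + by rewrite leqNgt pa; lia.
  + by rewrite leqNgt y2; lia.
  move=> x /eqP nxa /eqP nxb; rewrite -Pw !permM y2 tpermD ?y1 //; apply/eqP => E.
    by apply: nxa; rewrite E permK.
  by apply: nxb; rewrite E permK.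
- have Ei : i = i.-1.+1 by lia.
  case: (once _ (or_intror Ei)) => h; [left|right].
    by rewrite fixf Ea -?Ei.
  by rewrite wq /g word_fix Ea -?Ei.
- case: (once _ (or_introl erefl)) => h; [left|right].
    by rewrite fixf Eb.
  by rewrite wp /g word_fix Eb.
Qed.

End Cross.

(** * Inserting a letter *)

Section Backward.
Variable n : nat.
Local Open Scope group_scope.
Implicit Types (u v w : 'S_n) (s t : seq nat) (p q : 'I_n).

(** When the blocks are preserved, both points of an inversion lie in one block, so undoing it
    preserves the blocks again. *)
Lemma young_below i u x : young i u -> below u x -> young i x.
Proof.
move=> yu; apply: (below_ind (P := young i)) => // {}x y _ yx.
case/invstepP=> a [b [lab inv ->]] z; rewrite permM yx.
have := yx a; have := yx b.
by case: tpermP => [->|->|//] hb ha; lia.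
Qed.

Lemma not_young_sigma i : 0 < i < n -> ~ young i (sigma n i).
Proof.
by move=> vi; have [a [b [Ea Eb ->]]] := sigmaE vi => /(_ a); rewrite tpermL; lia.
Qed.

Lemma young_reduced i s u : 0 < i < n -> young i u -> reduced_word u s -> i \notin s.
Proof.
move=> vi yu red; apply/negP; rewrite -sub1seq => /(subword_below red).
by rewrite /= mulg1 => /(young_below yu) /(not_young_sigma vi).
Qed.

(** Letters below [i] move only points of the lower block and letters above [i] only points of the
    upper one; dropping one kind freezes its block. *)
Lemma word_filter i (eL eH : bool) s (x : 'I_n) : i \notin s ->
  word_prod n [seq j <- s | if j < i then eL else eH] x =
  if (if x < i then eL else eH) then word_prod n s x else x.
Proof.
elim: s x => [|j s IH] x /=; first by rewrite perm1 if_same.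
rewrite inE negb_or => /andP [nij nis].
have yj : young i (sigma n j) by apply: young_sigma; rewrite eq_sym.
have side : (x < i) = (j < i) \/ sigma n j x = x.
  case: (sigmaVE n j) => [->|/sigmaE [c [d [Ec Ed ->]]]]; first by right; rewrite perm1.
  case: tpermP => [->|->|]; [left|left|by right]; lia.
case: ifP => /= kj; rewrite !permM IH // ?yj.
  by case: side => [->|->]; [rewrite kj|case: ifP].
by case: side => [->|->//]; rewrite kj.
Qed.

(** Allows the parts on the two sides of the inserted letter to be thinned independently and then
    reassembled into one subword. *)
Lemma subseq_filterD (T : eqType) (K : pred T) (s t1 t2 : seq T) :
  subseq t1 (filter K s) -> subseq t2 (filter (predC K) s) ->
  exists s' : seq T, [/\ subseq s' s, filter K s' = t1 & filter (predC K) s' = t2].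
Proof.
elim: s t1 t2 => [|y s IH] t1 t2 /=.
  by case: t1 => //; case: t2 => // _ _; exists [::].
have skip : subseq t1 (filter K s) -> subseq t2 (filter (predC K) s) ->
    exists s' : seq T, [/\ subseq s' (y :: s), filter K s' = t1
                         & filter (predC K) s' = t2].
  move=> h1 h2; have [s' [ss' <- <-]] := IH _ _ h1 h2.
  by exists s'; split=> //; apply: subseq_trans ss' (subseq_cons _ _).
case: ifP => Ky /=.
  case: t1 skip => [|z t1] skip h1 h2; first exact: skip (sub0seq _) h2.
  move: h1 => /=; case: (z =P y) => [->|_] h1; last exact: skip.
  have [s' [ss' <- <-]] := IH _ _ h1 h2.
  by exists (y :: s'); rewrite /= eqxx Ky.
case: t2 skip => [|z t2] skip h1 h2; first exact: skip h1 (sub0seq _).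
move: h2 => /=; case: (z =P y) => [->|_] h2; last exact: skip.
have [s' [ss' <- <-]] := IH _ _ h1 h2.
by exists (y :: s'); rewrite /= eqxx Ky.
Qed.

Lemma subseq_catE (T : eqType) (s1 s2 t : seq T) : subseq t (s1 ++ s2) ->
  exists t1 t2 : seq T, [/\ t = t1 ++ t2, subseq t1 s1 & subseq t2 s2].
Proof.
elim: s1 t => [|x s1 IH] t /=; first by exists [::], t.
case: t => [|y t] /=; first by exists [::], [::]; rewrite !sub0seq.
case: (y =P x) => [->|_] /IH [t1 [t2 [-> h1 h2]]].
  by exists (x :: t1), t2; rewrite /= eqxx.
by exists t1, t2; split=> //; apply: subseq_trans h1 (subseq_cons _ _).
Qed.

Section Insert.
Variables (a b : 'I_n) (eL eH : bool).
Hypothesis Eab : b = a.+1 :> nat.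

(* [v_A * tperm a b * v_B], where [v_A] (resp. [v_B]) is [v] on the points satisfying
   (resp. violating) [keep] and the identity elsewhere. *)
Definition insert_cross v :=
  v * tperm (if eL then a else v a) (if eH then b else v b).

(** Read both on letters and on points: a letter other than [b] is below [b] exactly when the points
    it swaps are. *)
Definition keep (j : nat) := if j < b then eL else eH.

Definition insert_word s :=
  filter keep s ++ (b : nat) :: filter (predC keep) s.

Let b_valid : 0 < b < n. Proof. by rewrite ltn_ord Eab. Qed.

Let sigma_b : sigma n b = tperm a b.
Proof.
have [a' [b' [Ea Eb ->]]] := sigmaE b_valid.
by congr tperm; apply: val_inj => //=; rewrite Ea Eab.
Qed.

Let filterE s (x : 'I_n) : (b : nat) \notin s ->
  word_prod n (filter keep s) x = if keep x then word_prod n s x else x.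
Proof. by move=> nbs; rewrite (word_filter eL eH x nbs). Qed.

Let filterCE s (x : 'I_n) : (b : nat) \notin s ->
  word_prod n (filter (predC keep) s) x = if keep x then x else word_prod n s x.
Proof.
move=> nbs.
have -> : filter (predC keep) s = [seq j <- s | if j < b then ~~ eL else ~~ eH].
  by apply: eq_filter => j; rewrite /= /keep; case: ifP.
by rewrite word_filter // /keep; case: (x < b); [case: (eL)|case: (eH)].
Qed.

(** The factorisation of [v] into [v_A] and [v_B], which act on different blocks. *)
Lemma filter_prod s : (b : nat) \notin s ->
  word_prod n (filter keep s ++ filter (predC keep) s) = word_prod n s.
Proof.
move=> nbs; apply/permP => x; rewrite word_prod_cat permM filterE // filterCE //.
have E : keep (word_prod n s x) = keep x by rewrite /keep young_word.
by case kx: (keep x); rewrite ?E kx.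
Qed.

(** Moving [tperm a b] to the right past the second factor conjugates it, and that factor moves [a]
    or [b] only if the block of the point is not kept. *)
Lemma insert_word_prod s : (b : nat) \notin s ->
  word_prod n (insert_word s) = insert_cross (word_prod n s).
Proof.
move=> nbs; rewrite /insert_cross -{1}(filter_prod nbs) !word_prod_cat /= sigma_b.
set g := word_prod n (filter (predC keep) s).
have -> : (if eL then a else word_prod n s a) = g a.
  by rewrite /g filterCE // /keep Eab ltnS leqnn.
have -> : (if eH then b else word_prod n s b) = g b.
  by rewrite /g filterCE // /keep ltnn.
by rewrite -mulgA -tpermJ conjgE !mulgA mulgK.
Qed.

(** Moved to the left end instead, the transposition acts on positions; as [v] preserves the blocks,
    [p] and [q] stay on opposite sides. *)
Lemma insert_crossE v : young b v -> exists p q,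
  [/\ p < b, b <= q, insert_cross v = tperm p q * v,
      (p = if eL then v^-1 a else a) & (q = if eH then v^-1 b else b)].
Proof.
move=> yv; pose p := if eL then v^-1 a else a; pose q := if eH then v^-1 b else b.
have vp : v p = if eL then a else v a by rewrite /p; case: (eL); rewrite ?permKV.
have vq : v q = if eH then b else v b by rewrite /q; case: (eH); rewrite ?permKV.
exists p, q; split=> //.
- by rewrite -yv vp; case: (eL); rewrite ?yv Eab.
- by rewrite leqNgt -yv vq; case: (eH); rewrite ?yv ltnn.
by rewrite /insert_cross -vp -vq -tpermJ conjgE !mulgA mulgV mul1g.
Qed.

(** After the swap [p] alone crosses upwards and [q] alone downwards, so both can be recovered from
    the product. *)
Lemma tperm_cross v p q : young b v -> p < b -> b <= q ->
  forall x, (x == p) = (x < b) && (b <= (tperm p q * v)%g x) /\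
            (x == q) = (b <= x) && ((tperm p q * v)%g x < b).
Proof.
move=> yv lp lq x; have yv' z : (b <= v z) = (b <= z) by rewrite !(leqNgt b) yv.
rewrite permM yv yv' -!(inj_eq val_inj) /=.
case: tpermP => [->|->|nxp nxq]; try by split; lia.
have {}nxp : x <> p :> nat by move=> /val_inj.
have {}nxq : x <> q :> nat by move=> /val_inj.
by split; lia.
Qed.

Lemma insert_cross_not_young v : young b v -> ~ young b (insert_cross v).
Proof.
move=> yv; have [p [q [lp lq -> _ _]]] := insert_crossE yv.
move/(_ p); have := (tperm_cross yv lp lq p).1; rewrite eqxx lp => /esym.
by rewrite leqNgt => /negP.
Qed.

Lemma insert_cross_inj u v : young b u -> young b v ->
  insert_cross u = insert_cross v -> u = v.
Proof.
move=> yu yv.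
have [p [q [lp lq -> _ _]]] := insert_crossE yu.
have [p' [q' [lp' lq' -> _ _]]] := insert_crossE yv => E.
have Cu := tperm_cross yu lp lq; have Cv := tperm_cross yv lp' lq'.
have Ep : p = p' by apply/eqP; rewrite (Cv p).1 -E -(Cu p).1.
have Eq : q = q' by apply/eqP; rewrite (Cv q).2 -E -(Cu q).2.
by move: E; rewrite Ep Eq => /mulgI.
Qed.

(** Every word of [insert_cross u] inverts the crossing pair; exchange at this pair leaves a word of
    [u] with one letter less. *)
Lemma insert_word_reduced s u : young b u -> reduced_word u s ->
  reduced_word (insert_cross u) (insert_word s).
Proof.
move=> yu red; have nbs := young_reduced b_valid yu red.
have [vs Pu minu] := red; split; last 2 first.
- by rewrite insert_word_prod // Pu.
- move=> t vt Pt; have [p [q [lp lq Eq _ _]]] := insert_crossE yu.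
  have inv : word_prod n t q < word_prod n t p.
    have := (tperm_cross yu lp lq p).1; have := (tperm_cross yu lp lq q).2.
    by rewrite Pt Eq !eqxx => /esym/andP [_ h1] /esym/andP [_ h2]; exact: leq_trans h1 h2.
  have [t' [tt' -> Pt']] := strong_exchange (leq_trans lp lq) inv.
  rewrite Pt Eq mulgA tperm2 mul1g in Pt'.
  have := minu _ (subseq_valid tt' vt) Pt'.
  by rewrite -(count_predC keep s) size_cat /= !size_filter addnS ltnS.
rewrite valid_word_cat /= b_valid; apply/andP; split; apply/allP => j.
  by rewrite mem_filter => /andP [_ /(allP vs)].
by rewrite mem_filter => /andP [_ /(allP vs)].
Qed.

(** A subword of [insert_word s] either keeps or drops the letter [b], and its remaining letters
    come from one subword of [s]. These are the two copies of the interval below [u]. *)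
Lemma below_insert_cross u x : young b u ->
  below (insert_cross u) x <->
  below u x \/ exists2 y, below u y & x = insert_cross y.
Proof.
move=> yu; have [s red] := reduced_word_exists u.
have nbs := young_reduced b_valid yu red.
have redI := insert_word_reduced yu red.
have [_ Pu _] := red; have [_ PI _] := redI.
split; last first.
  have sub_ins s' : subseq s' s ->
      subseq (filter keep s' ++ filter (predC keep) s') (insert_word s) /\
      subseq (insert_word s') (insert_word s).
    move=> ss'; have mono K : subseq (filter K s') (filter K s).
      by rewrite subseq_filter filter_all (subseq_trans (filter_subseq _ _) ss').
    split; apply: cat_subseq; rewrite ?mono //=; last by rewrite eqxx.
    exact: subseq_trans (mono _) (subseq_cons _ _).
  have nb s' : subseq s' s -> (b : nat) \notin s'.
    by move=> ss'; apply: contraNN nbs => /(mem_subseq ss').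
  rewrite -{1 2}Pu; case=> [/below_subword [s' ss' <-]|[y /below_subword [s' ss' <-] ->]].
    rewrite -(filter_prod (nb _ ss')); exact: subword_below redI (sub_ins _ ss').1.
  rewrite -(insert_word_prod (nb _ ss')); exact: subword_below redI (sub_ins _ ss').2.
rewrite -PI => /below_subword [t sub <-].
have [t1 [t2 [-> h1 h2]]] := subseq_catE sub.
have [e [t3 [-> h3]]] : exists (e : bool) t3,
    t2 = (if e then [:: (b : nat)] else [::]) ++ t3 /\ subseq t3 (filter (predC keep) s).
  case: t2 h2 => [|j t2] /=; first by exists false, [::]; rewrite sub0seq.
  by case: (j =P b :> nat) => [->|_] h; [exists true, t2|exists false, (j :: t2)].
have [s' [ss' <- <-]] := subseq_filterD h1 h3.
have nb : (b : nat) \notin s' by apply: contraNN nbs => /(mem_subseq ss').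
have us' := subword_below red ss'.
case: e; last by left; rewrite filter_prod.
by right; exists (word_prod n s') => //; rewrite -insert_word_prod.
Qed.

Lemma below_insert_cross_young u x : young b u -> young b x ->
  below (insert_cross u) x -> below u x.
Proof.
move=> yu yx; rewrite below_insert_cross //; case=> // [[y uy E]].
by case: (insert_cross_not_young (young_below yu uy)); rewrite -E.
Qed.

Lemma below_insert_cross2 u x : young b u -> young b x ->
  below (insert_cross u) (insert_cross x) -> below u x.
Proof.
move=> yu yx; rewrite below_insert_cross //; case=> [ux|[y uy E]].
  by case: (insert_cross_not_young yx); apply: young_below ux.
by rewrite (insert_cross_inj yx (young_below yu uy) E).
Qed.

Lemma prism_insert_cross u : young b u -> prism (insert_cross u).
Proof.
move=> yu; pose w := insert_cross u.
pose T := {x : 'S_n | below u x}.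
pose elt (z : bool * T) := if z.1 then insert_cross (val z.2) else val z.2.
have yT (x : T) : young b (val x) := young_below yu (valP x).
have elt_le z : below w (elt z).
  apply/(below_insert_cross _ yu); case: z => [[] x]; rewrite /elt /=; last first.
    by left; apply: valP.
  by right; exists (val x) => //; apply: valP.
have eltE z1 z2 : below (elt z2) (elt z1) <-> (z1.1 ==> z2.1) /\ below (val z2.2) (val z1.2).
  case: z1 z2 => [e1 x1] [e2 x2]; rewrite /elt /=.
  case: e1 e2 => [] [] /=; split=> //.
  - by move/(below_insert_cross2 (yT _) (yT _)).
  - by case=> _ le12; apply/(below_insert_cross _ (yT _)); right; exists (val x1).
  - by move/(young_below (yT _))/(insert_cross_not_young (yT _)).
  - by case.
  - by move/(below_insert_cross_young (yT _) (yT _)).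
  - by case=> _ le12; apply/(below_insert_cross _ (yT _)); left.
  - by case.
have elt_inj : injective elt.
  move=> [e1 x1] [e2 x2] E.
  have [/= e12 x12] : ((e1, x1).1 ==> (e2, x2).1) /\ below (val x2) (val x1).
    by apply/(eltE (e1, x1) (e2, x2)); rewrite E; apply: connect0.
  have [/= e21 x21] : ((e2, x2).1 ==> (e1, x1).1) /\ below (val x1) (val x2).
    by apply/(eltE (e2, x2) (e1, x1)); rewrite E; apply: connect0.
  congr pair; first by case: e1 e2 e12 e21 {E} => [] [].
  by apply: val_inj; apply: below_anti.
pose g z : Bint w := exist _ (elt z) ((bruhat_leP _ _).2 (elt_le z)).
(* The inverse is found by search in the finite type [bool * T]; the second branch is a default
   never reached. *)
pose f (x : Bint w) := if [pick z | elt z == sval x] is Some z then z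
                       else (false, exist _ u (connect0 _ u) : T).
exists T, (fun x y => below (val y) (val x)); split.
  split=> [x|x y xy yx|x y z xy yz]; first exact: connect0.
  - by apply: val_inj; apply: below_anti.
  - exact: connect_trans yz xy.
have gK : cancel g f.
  move=> z; rewrite /f /=; case: pickP => [z' /eqP /elt_inj //|/(_ z)].
  by rewrite eqxx.
have fK : cancel f g.
  move=> [x le_x]; have wx := (bruhat_leP _ _).1 le_x.
  have [z Ez] : exists z, elt z = x.
    case/(below_insert_cross _ yu): wx => [ux|[y uy ->]].
      by exists (false, exist _ x ux).
    by exists (true, exist _ y uy).
  (* Equal permutations give equal elements of [Bint w] only by proof irrelevance. *)
  have -> : exist _ x le_x = g z.
    by case: x / Ez le_x wx => le_x wx; congr exist; apply: proof_irrelevance.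
  by rewrite gK.
exists f, g; split=> // x y.
by rewrite -{1}(fK x) -{1}(fK y) /= bruhat_leP eltE.
Qed.

End Insert.

(** Swapping the crossing pair back gives a block-preserving [u], from which [w] arises by inserting
    the letter [i]. *)
Lemma oneway_prism w i p q : oneway w i p q -> prism w.
Proof.
case=> [[lp lq wp wq cr] hL hH].
have ltan : i.-1 < n by have := ltn_ord q; lia.
have ltbn : i < n by have := ltn_ord q; lia.
pose a := Ordinal ltan; pose b := Ordinal ltbn.
have Eab : b = a.+1 :> nat by rewrite /=; lia.
have npq : p != q by apply/eqP => E; rewrite E in lp; lia.
pose u := tperm p q * w.
have up : u p = w q by rewrite permM tpermL.
have uq : u q = w p by rewrite permM tpermR.
have yu : young b u.
  move=> x; rewrite permM /=; case: tpermP => [->|->|/eqP nxp /eqP nxq]; last exact: cr.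
    by rewrite wq lp.
  by rewrite !ltnNge wp lq.
(* Each flag tests one half of a disjunction of [oneway]; where it fails, the other half gives
   [p = a] or [q = b]. *)
have -> : w = insert_cross a b (w q == a) (w p == b) u; last exact: prism_insert_cross.
rewrite /insert_cross.
have -> : (if w q == a then a else u a) = u p.
  case: eqP => [<-|nq]; first by rewrite up.
  case: hL => [pa|qa]; last by case: nq; apply: val_inj.
  by congr (u _); apply: val_inj; rewrite /= pa.
have -> : (if w p == b then b else u b) = u q.
  case: eqP => [<-|nq]; first by rewrite uq.
  case: hH => [pa|qa]; last by case: nq; apply: val_inj.
  by congr (u _); apply: val_inj; rewrite /= pa.
by rewrite -tpermJ conjgE !mulgA mulgV mul1g tperm2 mul1g.
Qed.

Theorem prismP w : prism w <-> exists i p q, oneway w i p q.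
Proof.
split=> [/prism_no_double_join [i [vi wi ndj]]|[i [p [q]]]]; last exact: oneway_prism.
by exists i; apply: oneway_of_no_double_join.
Qed.

End Backward.

(** * Mesh patterns *)

Section Patterns.
Variable n : nat.
Implicit Types (w : 'S_n) (p q : 'I_n).

(** As many points leave the lower block as enter it, so uniqueness of the crossing in one direction
    gives it in the other. A mesh thus has to control one direction only. *)
Lemma crossing_of_side w i p q :
    p < i -> i <= q -> i <= w p -> w q < i ->
    (forall x : 'I_n, i <= x -> x != q -> i <= w x) \/
    (forall x : 'I_n, x < i -> x != p -> w x < i) ->
  crossing w i p q.
Proof.
move=> lp lq wp wq side.
pose A := [set x : 'I_n | x < i]; pose B := [set x : 'I_n | w x < i].
have cAB : #|A| = #|B|.
  have -> : B = w @^-1: A by apply/setP => x; rewrite !inE.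
  by rewrite card_preimset //; apply: perm_inj.
have cD : #|A :\: B| = #|B :\: A|.
  by have := cardsID B A; have := cardsID A B; rewrite (setIC B A); lia.
have pAB : p \in A :\: B by rewrite !inE lp andbT -leqNgt.
have qBA : q \in B :\: A by rewrite !inE wq andbT -leqNgt.
have [EA EB] : A :\: B = [set p] /\ B :\: A = [set q].
  have {side} [E|E] : B :\: A = [set q] \/ A :\: B = [set p].
  - case: side => H; [left|right]; apply/eqP; rewrite eqEsubset sub1set ?pAB ?qBA andbT;
      apply/subsetP => x; rewrite !inE => /andP [h1 h2]; apply/negPn/negP => nx.
      by have := H x; rewrite leqNgt h1 nx leqNgt h2 => /(_ isT isT).
    by move: h1; rewrite (H x).
  - split=> //; apply/esym/eqP; rewrite eqEcard sub1set pAB cD E.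
    by rewrite !cards1.
  split=> //; apply/esym/eqP; rewrite eqEcard sub1set qBA -cD E.
  by rewrite !cards1.
split=> // x nxp nxq.
have := in_set1 x p; have := in_set1 x q; rewrite -EA -EB !inE.
by rewrite (negPf nxp) (negPf nxq); case: (x < i); case: (w x < i).
Qed.

Lemma wf_ord w (x : 'I_n) : wf w x.+1 = (w x).+1.
Proof.
rewrite /wf; case: insubP => [y _ E|]; last by rewrite ltn_ord.
by have -> : y = x by apply: val_inj.
Qed.

Lemma ord_pred_exists x : 0 < x <= n -> exists k : 'I_n, x = k.+1.
Proof.
by case: x => [//|x] lx; exists (Ordinal (lx : x < n)).
Qed.

Lemma wf_bound w x : 0 < x <= n -> 0 < wf w x <= n.
Proof. by move=> /ord_pred_exists [k ->]; rewrite wf_ord ltn_ord. Qed.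

Lemma wf_inj w x y : 0 < x <= n -> 0 < y <= n -> wf w x = wf w y -> x = y.
Proof.
move=> /ord_pred_exists [k ->] /ord_pred_exists [l ->].
by rewrite !wf_ord => -[/val_inj/perm_inj ->].
Qed.

Lemma wf_surj w y : 0 < y <= n -> exists2 x, 0 < x <= n & wf w x = y.
Proof.
move=> /ord_pred_exists [k ->]; exists ((w^-1)%g k).+1; first by rewrite /= ltn_ord.
by rewrite wf_ord permKV.
Qed.

(** Passage to 1-indexed points: the conditions [p = i.-1] and [q = i] become [P = i] and
    [Q = i.+1]. *)
Lemma wf_of_oneway w i p q : oneway w i p q ->
  exists P Q, [/\ 0 < P <= i, i < Q <= n, i < wf w P, wf w Q <= i &
    [/\ forall x, 0 < x <= n -> x <> P -> x <> Q -> (wf w x <= i) = (x <= i),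
        P = i \/ wf w Q = i & Q = i.+1 \/ wf w P = i.+1]].
Proof.
case=> [[lp lq wp wq cr] hL hH].
exists p.+1, q.+1; rewrite !wf_ord; have := ltn_ord q; split; rewrite ?lp //; try lia; split; try lia.
move=> _ /ord_pred_exists [x ->] nxp nxq; rewrite wf_ord; apply: cr.
  by apply/eqP => E; rewrite E in nxp.
by apply/eqP => E; rewrite E in nxq.
Qed.

Lemma oneway_of_wf w i P Q :
    0 < P <= i -> i < Q <= n -> i < wf w P -> wf w Q <= i ->
    (forall x, i < x <= n -> x <> Q -> i < wf w x) \/
    (forall x, 0 < x <= i -> x <> P -> wf w x <= i) ->
    P = i \/ wf w Q = i -> Q = i.+1 \/ wf w P = i.+1 ->
  exists i p q, oneway w i p q.
Proof.
move=> lP lQ wP wQ side hL hH.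
have [p Ep] : exists k : 'I_n, P = k.+1 by apply: ord_pred_exists; lia.
have [q Eq] : exists k : 'I_n, Q = k.+1 by apply: ord_pred_exists; lia.
subst P Q; rewrite !wf_ord in wP wQ side hL hH.
exists i, p, q; split; try lia.
apply: crossing_of_side => //; try lia.
case: side => H; [left|right] => x lx nx.
  have := H x.+1; rewrite wf_ord ltn_ord andbT; apply=> //.
  by case=> /val_inj E; rewrite E eqxx in nx.
have := H x.+1; rewrite wf_ord; apply=> //.
by case=> /val_inj E; rewrite E eqxx in nx.
Qed.

Lemma sort_leqE (s t : seq nat) : sorted ltn t -> perm_eq t s -> sort leq s = t.
Proof.
move=> st pts; apply: (sorted_eq leq_trans anti_leq).
- exact: (sort_sorted leq_total).
- by apply: sub_sorted st => x y /ltnW.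
by rewrite (perm_trans (permEl (perm_sort _ _))) // perm_sym.
Qed.

Definition grid (zs : seq nat) (a : nat) := nth 0 (0 :: rcons zs n.+1) a.

Lemma Xc_grid k zs a : size zs = k -> Xc n k zs a = grid zs a.
Proof.
move=> <-; rewrite /Xc /grid; case: a => [//|a] /=.
rewrite eqSS nth_rcons; have [h|h|h] := ltngtP a (size zs) => //.
by rewrite nth_default // ltnW.
Qed.

(** The value of rank [b] sits where [p] takes the value [b]; for an occurrence this lists the
    values in increasing order without sorting. *)
Definition values_of w (p xs : seq nat) :=
  [seq wf w (nth 0 xs (index b p)) | b <- iota 1 (size p)].

Lemma values_of_perm w (p xs : seq nat) :
  perm_eq p (iota 1 (size p)) -> size xs = size p ->
  perm_eq (values_of w p xs) (map (wf w) xs).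
Proof.
move=> pp sz; have up : uniq p by rewrite (perm_uniq pp) iota_uniq.
have -> : map (wf w) xs = [seq wf w (nth 0 xs (index b p)) | b <- p].
  apply: (@eq_from_nth _ 0); rewrite ?size_map // => j jx.
  by rewrite !(nth_map 0) -?sz // index_uniq -?sz.
by rewrite /values_of; apply: perm_map; rewrite perm_sym.
Qed.

Lemma order_sorted w (p xs : seq nat) : perm_eq p (iota 1 (size p)) ->
  (forall j l, j < size p -> l < size p ->
     (wf w (nth 0 xs j) < wf w (nth 0 xs l)) = (nth 0 p j < nth 0 p l)) <->
  sorted ltn (values_of w p xs).
Proof.
move=> pp; have up : uniq p by rewrite (perm_uniq pp) iota_uniq.
have memp b : (b \in p) = (0 < b < (size p).+1) by rewrite (perm_mem pp) mem_iota.
split=> [ord|srt].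
  rewrite /values_of; apply: (homo_sorted_in (e := ltn) (P := mem p)).
  - move=> b c bp cp /= bc; rewrite ord ?index_mem // !nth_index //.
  - by rewrite -(perm_all _ pp); apply/allP.
  exact: iota_ltn_sorted.
have nthv j : j < size p -> wf w (nth 0 xs j) = nth 0 (values_of w p xs) (nth 0 p j).-1.
  move=> jp; have : nth 0 p j \in p by apply: mem_nth.
  rewrite memp => b; rewrite (nth_map 0) ?size_iota; last by lia.
  rewrite nth_iota; last by lia.
  by rewrite add1n prednK ?index_uniq //; lia.
have mono j l : j < size p -> l < size p -> nth 0 p j < nth 0 p l ->
    wf w (nth 0 xs j) < wf w (nth 0 xs l).
  move=> jp lp jl; rewrite !nthv //.
  have : nth 0 p j \in p by apply: mem_nth.
  have : nth 0 p l \in p by apply: mem_nth.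
  rewrite !memp => bl bj.
  apply: (sorted_ltn_nth ltn_trans 0 srt); rewrite ?inE ?size_map ?size_iota; lia.
move=> j l jp lp; have [jl|lj|E] := ltngtP (nth 0 p j) (nth 0 p l).
- exact: mono.
- by apply/negbTE; rewrite -leqNgt ltnW // mono.
- have -> : j = l by apply/eqP; rewrite -(nth_uniq 0 jp lp up) E.
  by rewrite ltnn.
Qed.

(** For a concrete [p] this form consists of linear inequalities between positions and values. *)
Lemma contains_cmpE w (p : seq nat) M cx cy : perm_eq p (iota 1 (size p)) ->
  contains_cmp w p M cx cy <->
  exists xs, [/\ size xs = size p, sorted ltn xs,
    all (fun x => (0 < x) && (x <= n)) xs, sorted ltn (values_of w p xs) &
    [/\ forall a b, (a, b) \in M -> forall x,
          grid xs a < x < grid xs a.+1 ->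
          ~~ (grid (values_of w p xs) b < wf w x < grid (values_of w p xs) b.+1),
        all (fun c => Posz (grid xs c.1) == c.2) cx &
        all (fun c => Posz (grid (values_of w p xs) c.1) == c.2) cy]].
Proof.
move=> pp; have YcE xs b : size xs = size p -> sorted ltn (values_of w p xs) ->
    Yc (size p) w xs b = grid (values_of w p xs) b.
  move=> sz srt; rewrite /Yc (sort_leqE srt) ?Xc_grid ?size_map ?size_iota //.
  exact: values_of_perm.
split=> [[xs [[sz srt rng ord mesh] Hx Hy]]|[xs [sz srt rng srtv [mesh Hx Hy]]]].
  have srtv := (order_sorted w xs pp).1 ord.
  exists xs; split=> //; split.
  - by move=> a b /mesh H x; have := H x; rewrite !Xc_grid // !YcE.
  - by apply: sub_all Hx => c; rewrite Xc_grid.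
  - by apply: sub_all Hy => c; rewrite YcE.
exists xs; split.
- split=> //; first exact: (order_sorted w xs pp).2.
  by move=> a b /mesh H x; have := H x; rewrite !Xc_grid // !YcE.
- by apply: sub_all Hx => c; rewrite Xc_grid.
- by apply: sub_all Hy => c; rewrite YcE.
Qed.

End Patterns.

(** * From a pattern to a crossing *)

Section CrossingOfPatterns.
Variable n : nat.
Implicit Types (w : 'S_n).

(** Every value is attained, so a row without points has height one. *)
Lemma value_gap w c d : c < d -> d <= n ->
  (forall x, 0 < x <= n -> ~~ (c < wf w x < d)) -> d = c.+1.
Proof.
move=> lcd ldn gap; have [//|ne] := eqVneq d c.+1.
have [|x lx Ex] := @wf_surj n w c.+1; first by lia.
by have := gap x lx; rewrite Ex; lia.
Qed.

(** Supplies [lia] with both directions of the equivalence of [y = x] and equality of the values. *)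
Ltac at_pos w y x :=
  have := @wf_inj _ w y x; have := @f_equal _ _ (wf w) y x.

(** The empty row makes the two values adjacent, the calibration places the boundary, and the
    remaining cell controls one direction of crossing. *)
Lemma oneway_of_pattern1 w (i : int) :
  contains_cmp w [:: 2; 1] [:: (0, 1); (1, 1); (2, 1); (2, 0)]
    [:: (2, (i + 1)%R)] [:: (2, (i + 1)%R)] -> exists i p q, oneway w i p q.
Proof.
case/contains_cmpE => // -[|x1 [|x2 [|? ?]]] [] //= _ srt rng srtv [mesh cx cy].
rewrite /values_of /grid /= in srtv mesh cx cy.
have [b1 b2] : 0 < wf w x1 <= n /\ 0 < wf w x2 <= n by split; apply: wf_bound; lia.
have gap : wf w x1 = (wf w x2).+1.
  apply: (value_gap (w := w)) => [||y ly]; try lia.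
  have := mesh 0 1 isT y; have := mesh 1 1 isT y; have := mesh 2 1 isT y => /=.
  at_pos w y x1; at_pos w y x2; lia.
apply: (@oneway_of_wf n w x2.-1 x1 x2); try lia.
left=> y ly ny; have := mesh 2 0 isT y => /=.
have := @wf_bound _ w y; at_pos w y x1; at_pos w y x2; lia.
Qed.

Lemma oneway_of_pattern2 w (i : int) :
  contains_cmp w [:: 2; 1] [:: (1, 0); (1, 1); (1, 2); (0, 2)]
    [:: (2, (i + 1)%R)] [:: (2, (i + 1)%R)] -> exists i p q, oneway w i p q.
Proof.
case/contains_cmpE => // -[|x1 [|x2 [|? ?]]] [] //= _ srt rng srtv [mesh cx cy].
rewrite /values_of /grid /= in srtv mesh cx cy.
have [b1 b2] : 0 < wf w x1 <= n /\ 0 < wf w x2 <= n by split; apply: wf_bound; lia.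
have gap : x2 = x1.+1.
  (* Naming the successor keeps [wf w y] from unfolding under [/=]. *)
  have [y Ey] : exists y, y = x1.+1 by exists x1.+1.
  have [//|ne] := eqVneq x2 x1.+1; have hy : x1 < y < x2 by lia.
  have ly : 0 < y <= n by lia.
  have := mesh 1 0 isT y hy; have := mesh 1 1 isT y hy; have := mesh 1 2 isT y hy => /=.
  have := wf_bound w ly; have n1 := @wf_inj n w y x1 ly; have n2 := @wf_inj n w y x2 ly.
  clear mesh; lia.
apply: (@oneway_of_wf n w x1 x1 x2); try lia.
right=> y ly ny; have := mesh 0 2 isT y => /=.
have := @wf_bound _ w y; at_pos w y x1; lia.
Qed.

Lemma oneway_of_pattern3 w (i : int) :
  contains_cmp w [:: 2; 1] [:: (0, 1); (1, 1); (2, 1); (0, 2)]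
    [:: (1, i)] [:: (1, i)] -> exists i p q, oneway w i p q.
Proof.
case/contains_cmpE => // -[|x1 [|x2 [|? ?]]] [] //= _ srt rng srtv [mesh cx cy].
rewrite /values_of /grid /= in srtv mesh cx cy.
have [b1 b2] : 0 < wf w x1 <= n /\ 0 < wf w x2 <= n by split; apply: wf_bound; lia.
have gap : wf w x1 = (wf w x2).+1.
  apply: (value_gap (w := w)) => [||y ly]; try lia.
  have := mesh 0 1 isT y; have := mesh 1 1 isT y; have := mesh 2 1 isT y => /=.
  at_pos w y x1; at_pos w y x2; lia.
apply: (@oneway_of_wf n w x1 x1 x2); try lia.
right=> y ly ny; have := mesh 0 2 isT y => /=.
have := @wf_bound _ w y; at_pos w y x1; lia.
Qed.

Lemma oneway_of_pattern4 w (i : int) :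
  contains_cmp w [:: 2; 1] [:: (1, 0); (1, 1); (1, 2); (2, 0)]
    [:: (1, i)] [:: (1, i)] -> exists i p q, oneway w i p q.
Proof.
case/contains_cmpE => // -[|x1 [|x2 [|? ?]]] [] //= _ srt rng srtv [mesh cx cy].
rewrite /values_of /grid /= in srtv mesh cx cy.
have [b1 b2] : 0 < wf w x1 <= n /\ 0 < wf w x2 <= n by split; apply: wf_bound; lia.
have gap : x2 = x1.+1.
  have [y Ey] : exists y, y = x1.+1 by exists x1.+1.
  have [//|ne] := eqVneq x2 x1.+1; have hy : x1 < y < x2 by lia.
  have ly : 0 < y <= n by lia.
  have := mesh 1 0 isT y hy; have := mesh 1 1 isT y hy; have := mesh 1 2 isT y hy => /=.
  have := wf_bound w ly; have n1 := @wf_inj n w y x1 ly; have n2 := @wf_inj n w y x2 ly.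
  clear mesh; lia.
apply: (@oneway_of_wf n w x1 x1 x2); try lia.
left=> y ly ny; have := mesh 2 0 isT y => /=.
have := @wf_bound _ w y; at_pos w y x2; lia.
Qed.

Lemma mem_values_of w (p xs : seq nat) x :
    perm_eq p (iota 1 (size p)) -> size xs = size p ->
    all (fun x => (0 < x) && (x <= n)) xs -> 0 < x <= n ->
  (wf w x \in values_of w p xs) = (x \in xs).
Proof.
move=> pp sz rng lx; rewrite (perm_mem (values_of_perm w pp sz)).
apply/mapP/idP => [[z zx E]|xx]; last by exists x.
by have lz := allP rng z zx; rewrite (wf_inj lx lz E).
Qed.

Section FourPoints.
Variables (w : 'S_n) (p : seq nat) (M : seq (nat * nat)) (x1 x2 x3 x4 : nat).
Variables (y1 y2 y3 y4 : nat).
Let xs := [:: x1; x2; x3; x4].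
Let ys := [:: y1; y2; y3; y4].
Hypothesis perm_p : perm_eq p (iota 1 4).
Hypothesis ysE : values_of w p xs = ys.
Hypothesis srt : sorted ltn xs.
Hypothesis rng : all (fun x => (0 < x) && (x <= n)) xs.
Hypothesis srtv : sorted ltn ys.
Hypothesis mesh : forall a b, (a, b) \in M -> forall x,
  grid n xs a < x < grid n xs a.+1 -> ~~ (grid n ys b < wf w x < grid n ys b.+1).

Let off_grid x : 0 < x <= n -> x \notin xs ->
  [/\ wf w x <> y1, wf w x <> y2, wf w x <> y3, wf w x <> y4 & 0 < wf w x <= n].
Proof.
move=> lx nx; have sz : size p = 4 by rewrite (perm_size perm_p).
have : wf w x \notin ys by rewrite -ysE mem_values_of ?sz.
rewrite !inE !negb_or => /and4P [/eqP n1 /eqP n2 /eqP n3 /eqP n4].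
by split=> //; apply: wf_bound.
Qed.

(** A point strictly between [x2] and [x3] would lie in one of the five empty cells of the central
    column. *)
Lemma meshR_position : {subset meshR <= M} -> x3 = x2.+1.
Proof.
move=> sub; move: srt rng => /= sx rx.
have [//|ne] := eqVneq x3 x2.+1.
have [x Ex] : exists x, x = x2.+1 by exists x2.+1.
have hx : x2 < x < x3 by lia.
have [||n1 n2 n3 n4 bx] := @off_grid x; first by lia.
  by rewrite !inE; lia.
have m b : (2, b) \in meshR -> _ := fun h => mesh (sub _ h) hx.
have := m 0 isT; have := m 1 isT; have := m 2 isT; have := m 3 isT; have := m 4 isT.
by rewrite /grid /=; move: n1 n2 n3 n4 bx; clear; lia.
Qed.

Lemma meshR_value : {subset meshR <= M} -> y3 = y2.+1.
Proof.
move=> sub; move: srt rng srtv => /= sx rx sy.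
have yn : y3 <= n.
  have : y3 \in ys by rewrite !inE eqxx !orbT.
  rewrite -ysE (perm_mem (values_of_perm w _ _)) ?(perm_size perm_p) //.
  by case/mapP => z /(allP rng) lz ->; case/andP: (wf_bound w lz).
apply: (value_gap (w := w)) => //; first by lia.
move=> x lx; have [xx|nx] := boolP (x \in xs).
  have : wf w x \in ys by rewrite -ysE mem_values_of ?(perm_size perm_p).
  by rewrite !inE; move: sy; clear; lia.
have m a : (a, 2) \in meshR -> _ := fun h => @mesh a 2 (sub _ h) x.
have := m 0 isT; have := m 1 isT; have := m 2 isT; have := m 3 isT; have := m 4 isT.
rewrite /grid /=; move: nx; rewrite !inE; move: lx sx; clear; lia.
Qed.

(** Up to grid lines, [meshD] is the region right of [x3] and below [y3]; [meshU] is the opposite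
    region, left of [x3] and above [y3]. *)
Lemma meshD_side x : {subset meshD <= M} -> x3 < x <= n -> x \notin xs -> y3 < wf w x.
Proof.
move=> sub lx nx; move: srt rng => /= sx rx.
have [||n1 n2 n3 n4 bx] := @off_grid x => //; first by lia.
have [lt|gt] : x3 < x < x4 \/ x4 < x < n.+1 by move: nx; rewrite !inE; lia.
  have m b : (3, b) \in meshD -> _ := fun h => mesh (sub _ h) lt.
  have := m 0 isT; have := m 1 isT; have := m 2 isT.
  by rewrite /grid /=; move: n1 n2 n3 bx; clear; lia.
have m b : (4, b) \in meshD -> _ := fun h => mesh (sub _ h) gt.
have := m 0 isT; have := m 1 isT; have := m 2 isT.
by rewrite /grid /=; move: n1 n2 n3 bx; clear; lia.
Qed.

Lemma meshU_side x : {subset meshU <= M} -> 0 < x < x3 -> x \notin xs -> wf w x < y3.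
Proof.
move=> sub lx nx; move: srt rng => /= sx rx.
have [||n1 n2 n3 n4 bx] := @off_grid x => //; first by lia.
have [a la ax] : exists2 a, a < 3 & grid n xs a < x < grid n xs a.+1.
  have : [\/ 0 < x < x1, x1 < x < x2 | x2 < x < x3].
    move: nx; rewrite !inE => nx.
    have [h|h|h] := ltngtP x x1; [constructor 1| |]; try lia.
    by have [h'|h'|h'] := ltngtP x x2; [constructor 2|constructor 3|]; lia.
  by case=> h; [exists 0|exists 1|exists 2].
have [m3 m4] : (a, 3) \in meshU /\ (a, 4) \in meshU by case: a la {ax} => [|[|[|a]]].
have := mesh (sub _ m3) ax; have := mesh (sub _ m4) ax.
by rewrite /grid /=; move: n3 n4 bx; clear; lia.
Qed.

End FourPoints.

(** In each pattern of length four the boundary separates the second line from the third in both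
    directions. So [P] is the point of the first half with entry above 2, and [Q] that of the second
    half with entry at most 2. *)
Lemma oneway_of_pattern5 w (i : int) :
  contains_cmp w [:: 4; 1; 2; 3] (meshR ++ meshD) [:: (2, i)] [:: (2, i)] ->
  exists i p q, oneway w i p q.
Proof.
case/contains_cmpE => // -[|x1 [|x2 [|x3 [|x4 [|? ?]]]]] [] // _ srt rng srtv [mesh cx cy].
have pp : perm_eq [:: 4; 1; 2; 3] (iota 1 4) by [].
have ysE : values_of w [:: 4; 1; 2; 3] [:: x1; x2; x3; x4] =
  [:: wf w x2; wf w x3; wf w x4; wf w x1] by [].
rewrite ysE in srtv mesh cy.
have subR : {subset meshR <= meshR ++ meshD} by apply/allP.
have subD : {subset meshD <= meshR ++ meshD} by apply/allP.
have gx := meshR_position pp ysE srt rng srtv mesh subR.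
have gy := meshR_value pp ysE srt rng srtv mesh subR.
have side y ly nxs :=
  @meshD_side _ _ _ _ _ _ _ _ _ _ _ pp ysE srt rng srtv mesh y subD ly nxs.
move: srt rng srtv cx cy; rewrite /grid /= => srt rng srtv cx cy.
apply: (@oneway_of_wf n w x2 x1 x3); try lia.
left=> y ly ny.
have [|nyx] := boolP (y \in [:: x1; x2; x3; x4]).
  by rewrite !inE => /or4P [] /eqP E; rewrite E in ly ny *; lia.
have hy : x3 < y <= n by move: nyx; rewrite !inE; lia.
by have := side y hy nyx; lia.
Qed.

Lemma oneway_of_pattern6 w (i : int) :
  contains_cmp w [:: 2; 3; 4; 1] (meshR ++ meshU) [:: (2, i)] [:: (2, i)] ->
  exists i p q, oneway w i p q.
Proof.
case/contains_cmpE => // -[|x1 [|x2 [|x3 [|x4 [|? ?]]]]] [] // _ srt rng srtv [mesh cx cy].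
have pp : perm_eq [:: 2; 3; 4; 1] (iota 1 4) by [].
have ysE : values_of w [:: 2; 3; 4; 1] [:: x1; x2; x3; x4] =
  [:: wf w x4; wf w x1; wf w x2; wf w x3] by [].
rewrite ysE in srtv mesh cy.
have subR : {subset meshR <= meshR ++ meshU} by apply/allP.
have subU : {subset meshU <= meshR ++ meshU} by apply/allP.
have gx := meshR_position pp ysE srt rng srtv mesh subR.
have gy := meshR_value pp ysE srt rng srtv mesh subR.
have side y ly nxs :=
  @meshU_side _ _ _ _ _ _ _ _ _ _ _ pp ysE srt rng srtv mesh y subU ly nxs.
move: srt rng srtv cx cy; rewrite /grid /= => srt rng srtv cx cy.
apply: (@oneway_of_wf n w x2 x2 x4); try lia.
right=> y ly ny.
have [|nyx] := boolP (y \in [:: x1; x2; x3; x4]).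
  by rewrite !inE => /or4P [] /eqP E; rewrite E in ly ny *; lia.
have hy : 0 < y < x3 by move: nyx; rewrite !inE; lia.
by have := side y hy nyx; lia.
Qed.

Lemma oneway_of_pattern7 w (i : int) :
  contains_cmp w [:: 3; 1; 4; 2] (meshR ++ meshU ++ meshD) [:: (2, i)] [:: (2, i)] ->
  exists i p q, oneway w i p q.
Proof.
case/contains_cmpE => // -[|x1 [|x2 [|x3 [|x4 [|? ?]]]]] [] // _ srt rng srtv [mesh cx cy].
have pp : perm_eq [:: 3; 1; 4; 2] (iota 1 4) by [].
have ysE : values_of w [:: 3; 1; 4; 2] [:: x1; x2; x3; x4] =
  [:: wf w x2; wf w x4; wf w x1; wf w x3] by [].
rewrite ysE in srtv mesh cy.
have subR : {subset meshR <= meshR ++ meshU ++ meshD} by apply/allP.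
have subD : {subset meshD <= meshR ++ meshU ++ meshD} by apply/allP.
have gx := meshR_position pp ysE srt rng srtv mesh subR.
have gy := meshR_value pp ysE srt rng srtv mesh subR.
have side y ly nxs :=
  @meshD_side _ _ _ _ _ _ _ _ _ _ _ pp ysE srt rng srtv mesh y subD ly nxs.
move: srt rng srtv cx cy; rewrite /grid /= => srt rng srtv cx cy.
apply: (@oneway_of_wf n w x2 x1 x4); try lia.
left=> y ly ny.
have [|nyx] := boolP (y \in [:: x1; x2; x3; x4]).
  by rewrite !inE => /or4P [] /eqP E; rewrite E in ly ny *; lia.
have hy : x3 < y <= n by move: nyx; rewrite !inE; lia.
by have := side y hy nyx; lia.
Qed.

Lemma oneway_of_pattern8 w (i : int) :
  contains_cmp w [:: 2; 4; 1; 3] (meshR ++ meshU ++ meshD) [:: (2, i)] [:: (2, i)] ->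
  exists i p q, oneway w i p q.
Proof.
case/contains_cmpE => // -[|x1 [|x2 [|x3 [|x4 [|? ?]]]]] [] // _ srt rng srtv [mesh cx cy].
have pp : perm_eq [:: 2; 4; 1; 3] (iota 1 4) by [].
have ysE : values_of w [:: 2; 4; 1; 3] [:: x1; x2; x3; x4] =
  [:: wf w x3; wf w x1; wf w x4; wf w x2] by [].
rewrite ysE in srtv mesh cy.
have subR : {subset meshR <= meshR ++ meshU ++ meshD} by apply/allP.
have subD : {subset meshD <= meshR ++ meshU ++ meshD} by apply/allP.
have gx := meshR_position pp ysE srt rng srtv mesh subR.
have gy := meshR_value pp ysE srt rng srtv mesh subR.
have side y ly nxs :=
  @meshD_side _ _ _ _ _ _ _ _ _ _ _ pp ysE srt rng srtv mesh y subD ly nxs.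
move: srt rng srtv cx cy; rewrite /grid /= => srt rng srtv cx cy.
apply: (@oneway_of_wf n w x2 x2 x3); try lia.
left=> y ly ny.
have [|nyx] := boolP (y \in [:: x1; x2; x3; x4]).
  by rewrite !inE => /or4P [] /eqP E; rewrite E in ly ny *; lia.
have hy : x3 < y <= n by move: nyx; rewrite !inE; lia.
by have := side y hy nyx; lia.
Qed.

End CrossingOfPatterns.

(** * From a crossing to a pattern *)

Section PatternsOfCrossing.

Variables (n : nat) (w : 'S_n) (i P Q : nat).
Hypotheses (lP : 0 < P <= i) (lQ : i < Q <= n) (wP : i < wf w P) (wQ : wf w Q <= i).
Hypothesis cross : forall x, 0 < x <= n -> x <> P -> x <> Q -> (wf w x <= i) = (x <= i).

Let bound_P : 0 < wf w P <= n. Proof. by apply: wf_bound; lia. Qed.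
Let bound_Q : 0 < wf w Q <= n. Proof. by apply: wf_bound; lia. Qed.

(** Each cell of the mesh lies between adjacent lines or could only hold another crossing point. *)
Lemma pattern1_of_wf : wf w Q = i -> Q = i.+1 -> wf w P = i.+1 ->
  contains_cmp w [:: 2; 1] [:: (0, 1); (1, 1); (2, 1); (2, 0)]
    [:: (2, (Posz i + 1)%R)] [:: (2, (Posz i + 1)%R)].
Proof.
move=> B C D; apply/(contains_cmpE w _ _ _ (isT : perm_eq [:: 2; 1] (iota 1 2))).
exists [:: P; Q]; split=> //=; try lia.
rewrite /values_of /grid /=; split; try lia.
move=> a b; rewrite !inE => ab x hx; have := cross (x := x).
by case/or4P: ab hx => /eqP [-> ->] /=; lia.
Qed.

Lemma pattern2_of_wf : P = i -> Q = i.+1 -> wf w P = i.+1 ->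
  contains_cmp w [:: 2; 1] [:: (1, 0); (1, 1); (1, 2); (0, 2)]
    [:: (2, (Posz i + 1)%R)] [:: (2, (Posz i + 1)%R)].
Proof.
move=> A C D; apply/(contains_cmpE w _ _ _ (isT : perm_eq [:: 2; 1] (iota 1 2))).
exists [:: P; Q]; split=> //=; try lia.
rewrite /values_of /grid /=; split; try lia.
move=> a b; rewrite !inE => ab x hx; have := cross (x := x).
by case/or4P: ab hx => /eqP [-> ->] /=; lia.
Qed.

Lemma pattern3_of_wf : P = i -> wf w Q = i -> wf w P = i.+1 ->
  contains_cmp w [:: 2; 1] [:: (0, 1); (1, 1); (2, 1); (0, 2)]
    [:: (1, Posz i)] [:: (1, Posz i)].
Proof.
move=> A B D; apply/(contains_cmpE w _ _ _ (isT : perm_eq [:: 2; 1] (iota 1 2))).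
exists [:: P; Q]; split=> //=; try lia.
rewrite /values_of /grid /=; split; try lia.
move=> a b; rewrite !inE => ab x hx; have := cross (x := x).
by case/or4P: ab hx => /eqP [-> ->] /=; lia.
Qed.

Lemma pattern4_of_wf : P = i -> wf w Q = i -> Q = i.+1 ->
  contains_cmp w [:: 2; 1] [:: (1, 0); (1, 1); (1, 2); (2, 0)]
    [:: (1, Posz i)] [:: (1, Posz i)].
Proof.
move=> A B C; apply/(contains_cmpE w _ _ _ (isT : perm_eq [:: 2; 1] (iota 1 2))).
exists [:: P; Q]; split=> //=; try lia.
rewrite /values_of /grid /=; split; try lia.
move=> a b; rewrite !inE => ab x hx; have := cross (x := x).
by case/or4P: ab hx => /eqP [-> ->] /=; lia.
Qed.

(** With middle lines [i] and [i.+1], the central row and column are too thin for a point. A point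
    in [meshU] or [meshD] would cross the boundary, while [P] and [Q] already lie on grid lines. *)
Lemma contains_cmp4_of_wf (p : seq nat) M x1 x4 y1 y4 :
    perm_eq p (iota 1 4) -> {subset M <= meshR ++ meshU ++ meshD} ->
    0 < x1 < i -> i.+1 < x4 <= n ->
    values_of w p [:: x1; i; i.+1; x4] = [:: y1; i; i.+1; y4] ->
    y1 < i -> i.+1 < y4 -> P \in [:: x1; i] -> Q \in [:: i.+1; x4] ->
  contains_cmp w p M [:: (2, Posz i)] [:: (2, Posz i)].
Proof.
move=> pp sub l1 l4 ysE h1 h4 PM QM.
have sz : size p = 4 by rewrite (perm_size pp).
apply/contains_cmpE; first by rewrite sz.
exists [:: x1; i; i.+1; x4]; rewrite sz ysE; split=> //=; try lia.
rewrite /grid /= !eqxx; split=> // a b /sub ab x.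
have {ab} : [|| a == 2, b == 2, (a < 3) && (2 < b < 5) | (2 < a < 5) && (b < 3)].
  have H : all (fun c : nat * nat => [|| c.1 == 2, c.2 == 2,
      (c.1 < 3) && (2 < c.2 < 5) | (2 < c.1 < 5) && (c.2 < 3)])
    (meshR ++ meshU ++ meshD) by [].
  exact: (allP H _ ab).
have side : 0 < x <= n -> x \notin [:: x1; i; i.+1; x4] -> (wf w x <= i) = (x <= i).
  move=> lx nx; apply: cross => // E; move: nx; rewrite E.
    by move: PM; rewrite !inE => /orP [] ->; rewrite ?orbT.
  by move: QM; rewrite !inE => /orP [] ->; rewrite ?orbT.
have off : 0 < x <= n -> x <> x1 -> x <> i -> x <> i.+1 -> x <> x4 ->
    (wf w x <= i) = (x <= i).
  by move=> lx *; apply: side => //; rewrite !inE; lia.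
clear side PM QM sub ysE cross.
case/or4P => [/eqP -> /=|/eqP -> _ /=|/andP [la lb] hx|/andP [la lb] hx]; try lia.
  have {off} : wf w x <= i.
    rewrite off; try by case: a la hx => [|[|[|a]]] //= _; lia.
  by case: b lb => [|[|[|[|[|b]]]]] //= _; lia.
have {off} : i < wf w x.
  rewrite ltnNge off; try by case: a la hx => [|[|[|[|[|a]]]]] //= _; lia.
by case: b lb => [|[|[|b]]] //= _; lia.
Qed.

(** Here and in the next three cases the occurrence consists of [P], [Q], the points at positions
    [i] and [i.+1], and those with values [i] and [i.+1]; coincidences leave exactly four. *)
Lemma pattern5_of_wf : wf w Q = i -> Q = i.+1 -> P <> i -> wf w P <> i.+1 ->
  contains_cmp w [:: 4; 1; 2; 3] (meshR ++ meshD) [:: (2, Posz i)] [:: (2, Posz i)].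
Proof.
move=> B C nA nD.
have [x4 l4 E4] : exists2 x, 0 < x <= n & wf w x = i.+1 by apply: wf_surj; lia.
have n4P : x4 <> P by move=> E; rewrite E in E4.
have n4Q : x4 <> Q by move=> E; rewrite E in E4; lia.
have c4 := cross l4 n4P n4Q; have li : 0 < i <= n by lia.
have niQ : i <> Q by lia.
have ci := cross li (nesym nA) niQ; have inj := @wf_inj n w i Q li.
apply: (@contains_cmp4_of_wf _ _ P x4 (wf w i) (wf w P)) => //; try lia.
- by apply/allP.
- by rewrite /values_of -C /= B E4 C.
- by rewrite inE eqxx.
by rewrite inE C eqxx.
Qed.

Lemma pattern6_of_wf : P = i -> wf w P = i.+1 -> wf w Q <> i -> Q <> i.+1 ->
  contains_cmp w [:: 2; 3; 4; 1] (meshR ++ meshU) [:: (2, Posz i)] [:: (2, Posz i)].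
Proof.
move=> A D nB nC.
have [x1 l1 E1] : exists2 x, 0 < x <= n & wf w x = i by apply: wf_surj; lia.
have n1P : x1 <> P by move=> E; rewrite E in E1; lia.
have n1Q : x1 <> Q by move=> E; rewrite E in E1.
have c1 := cross l1 n1P n1Q; have [k Ek] : exists k, k = i.+1 by exists i.+1.
have lk : 0 < k <= n by lia.
have nkP : k <> P by lia.
have nkQ : k <> Q by rewrite Ek; exact: nesym.
have ck := cross lk nkP nkQ; have inj := @wf_inj n w k P lk.
apply: (@contains_cmp4_of_wf _ _ x1 Q (wf w Q) (wf w k)) => //; try lia.
- by apply/allP.
- have Ei : wf w i = i.+1 by rewrite -{1}A.
  by rewrite /values_of -Ek /= E1 Ei Ek.
- by rewrite !inE A eqxx orbT.
by rewrite !inE eqxx orbT.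
Qed.

Lemma pattern7_of_wf : wf w Q = i -> wf w P = i.+1 -> P <> i -> Q <> i.+1 ->
  contains_cmp w [:: 3; 1; 4; 2] (meshR ++ meshU ++ meshD)
    [:: (2, Posz i)] [:: (2, Posz i)].
Proof.
move=> B D nA nC; have [k Ek] : exists k, k = i.+1 by exists i.+1.
have li : 0 < i <= n by lia.
have niQ : i <> Q by lia.
have ci := cross li (nesym nA) niQ; have inji := @wf_inj n w i Q li.
have lk : 0 < k <= n by lia.
have nkP : k <> P by lia.
have nkQ : k <> Q by rewrite Ek; exact: nesym.
have ck := cross lk nkP nkQ; have injk := @wf_inj n w k P lk.
apply: (@contains_cmp4_of_wf _ _ P Q (wf w i) (wf w k)) => //; try lia.
- by rewrite /values_of -Ek /= B D Ek.
- by rewrite !inE eqxx.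
by rewrite !inE eqxx orbT.
Qed.

Lemma pattern8_of_wf : P = i -> Q = i.+1 -> wf w Q <> i -> wf w P <> i.+1 ->
  contains_cmp w [:: 2; 4; 1; 3] (meshR ++ meshU ++ meshD)
    [:: (2, Posz i)] [:: (2, Posz i)].
Proof.
move=> A C nB nD.
have [x1 l1 E1] : exists2 x, 0 < x <= n & wf w x = i by apply: wf_surj; lia.
have n1P : x1 <> P by move=> E; rewrite E in E1; lia.
have n1Q : x1 <> Q by move=> E; rewrite E in E1.
have c1 := cross l1 n1P n1Q.
have [x4 l4 E4] : exists2 x, 0 < x <= n & wf w x = i.+1 by apply: wf_surj; lia.
have n4P : x4 <> P by move=> E; rewrite E in E4.
have n4Q : x4 <> Q by move=> E; rewrite E in E4; lia.
have c4 := cross l4 n4P n4Q.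
apply: (@contains_cmp4_of_wf _ _ x1 x4 (wf w Q) (wf w P)) => //; try lia.
- by rewrite /values_of -C /= E1 E4 C A.
- by rewrite !inE A eqxx orbT.
by rewrite !inE C eqxx.
Qed.

End PatternsOfCrossing.

Theorem theorem3p7 (n : nat) (w : 'S_n) :
  prism w <->
  exists i : int,
    (contains_cmp w [:: 2; 1] [:: (0, 1); (1, 1); (2, 1); (2, 0)]
       [:: (2, (i + 1)%R)] [:: (2, (i + 1)%R)]) \/
    (contains_cmp w [:: 2; 1] [:: (1, 0); (1, 1); (1, 2); (0, 2)]
       [:: (2, (i + 1)%R)] [:: (2, (i + 1)%R)]) \/
    (contains_cmp w [:: 2; 1] [:: (0, 1); (1, 1); (2, 1); (0, 2)]
       [:: (1, i)] [:: (1, i)]) \/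
    (contains_cmp w [:: 2; 1] [:: (1, 0); (1, 1); (1, 2); (2, 0)]
       [:: (1, i)] [:: (1, i)]) \/
    (contains_cmp w [:: 4; 1; 2; 3] (meshR ++ meshD) [:: (2, i)] [:: (2, i)]) \/
    (contains_cmp w [:: 2; 3; 4; 1] (meshR ++ meshU) [:: (2, i)] [:: (2, i)]) \/
    (contains_cmp w [:: 3; 1; 4; 2] (meshR ++ meshU ++ meshD) [:: (2, i)] [:: (2, i)]) \/
    (contains_cmp w [:: 2; 4; 1; 3] (meshR ++ meshU ++ meshD) [:: (2, i)] [:: (2, i)]).
Proof.
rewrite prismP; split=> [[i [p [q /wf_of_oneway]]]|[i]].
  case=> P [Q [lP lQ wP wQ [cross hL hH]]]; exists (Posz i).
  (* Each disjunction gives one of its two equalities. If at least three of the four hold, one of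
     the patterns of length two occurs; if one from each disjunction holds, one of those of length
     four. *)
  have [B|/eqP nB] := eqVneq (wf w Q) i; have [D|/eqP nD] := eqVneq (wf w P) i.+1.
  - have [C|/eqP nC] := eqVneq Q i.+1; first by left; apply: (pattern1_of_wf (P := P) (Q := Q)).
    have [A|/eqP nA] := eqVneq P i.
      by right; right; left; apply: (pattern3_of_wf (P := P) (Q := Q)).
    by do 6!right; left; apply: (pattern7_of_wf (P := P) (Q := Q)).
  - have C : Q = i.+1 by case: hH.
    have [A|/eqP nA] := eqVneq P i.
      by do 3!right; left; apply: (pattern4_of_wf (P := P) (Q := Q)).
    by do 4!right; left; apply: (pattern5_of_wf (P := P) (Q := Q)).
  - have A : P = i by case: hL.
    have [C|/eqP nC] := eqVneq Q i.+1.
      by right; left; apply: (pattern2_of_wf (P := P) (Q := Q)).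
    by do 5!right; left; apply: (pattern6_of_wf (P := P) (Q := Q)).
  have A : P = i by case: hL.
  have C : Q = i.+1 by case: hH.
  by do 7!right; apply: (pattern8_of_wf (P := P) (Q := Q)).
case=> [|[|[|[|[|[|[|]]]]]]].
- exact: oneway_of_pattern1.
- exact: oneway_of_pattern2.
- exact: oneway_of_pattern3.
- exact: oneway_of_pattern4.
- exact: oneway_of_pattern5.
- exact: oneway_of_pattern6.
- exact: oneway_of_pattern7.
- exact: oneway_of_pattern8.
Qed.
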